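(* Let $(A,\Delta)$ be a multiplier Hopf $^*$-algebra with positive integrals, let $\varphi$ be a positive left integral and $\psi$ a positive right integral on $A$, let $\varepsilon$ be the counit, $S$ the antipode and $\widehat A$ the dual multiplier Hopf $^*$-algebra. (i) Define $\widehat\psi$ on $\widehat A$ by $\widehat\psi(b)=\varepsilon(a)$ if $b=\varphi(\,\cdot\,a)$ with $a\in A$. Then $\widehat\psi(b^*b)=\varphi(a^*a)$ when $b=\varphi(\,\cdot\,a)$, for all $a\in A$. (ii) Define $\widehat\varphi$ on $\widehat A$ by $\widehat\varphi(b)=\varepsilon(a)$ if $b=\psi(S(\,\cdot\,)a)$ with $a\in A$. Then $\widehat\varphi(b^*b)=\psi(a^*a)$ when $b=\psi(S(\,\cdot\,)a)$, for all $a\in A$.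
   Context: A multiplier Hopf $^*$-algebra $(A,\Delta)$ is a $^*$-algebra $A$ over $\mathbb C$ with non-degenerate product (possibly without unit), with multiplier algebra $M(A)$, and a coassociative $^*$-homomorphism $\Delta:A\to M(A\otimes A)$ (algebraic tensor product) such that $a\otimes a'\mapsto\Delta(a)(1\otimes a')$ and $a\otimes a'\mapsto(a\otimes1)\Delta(a')$ are bijections of $A\otimes A$ onto itself. It has a unique counit $\varepsilon$ and antipode $S$, with $S(S(a)^* )^*=a$. A left integral is a non-zero linear functional $\varphi$ on $A$ with $(\iota\otimes\varphi)\Delta(a)=\varphi(a)1$ for all $a$, a right integral is a non-zero linear functional $\psi$ with $(\psi\otimes\iota)\Delta(a)=\psi(a)1$ (equalities in $M(A)$). Integrals are unique up to a scalar and faithful. A functional $\omega$ is positive if $\omega(a^*a)\ge0$ for all $a$. ''With positive integrals'' means that positive left and right integrals exist. The dual $\widehat A$ is the space of linear functionals on $A$ of the form $\varphi(\,\cdot\,a)$ with $a\in A$; it equals the space of functionals $\psi(S(\,\cdot\,)a)$ with $a\in A$, and in both cases $a$ is uniquely determined by the functional. Here $\varphi(\,\cdot\,a)$ is the functional $x\mapsto\varphi(xa)$ and $\psi(S(\,\cdot\,)a)$ is $x\mapsto\psi(S(x)a)$. Write $\langle a,b\rangle=b(a)$ for $a\in A$, $b\in\widehat A$. The product is $\langle a,bb'\rangle=\sum_{(a)}\langle a_{(1)},b\rangle\langle a_{(2)},b'\rangle$ and the involution is $\langle a,b^*\rangle=\overline{\langle S(a)^*,b\rangle}$. *)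

(* Defs.v *)
From HB Require Import structures.
From mathcomp Require Import all_boot all_order all_algebra generic_quotient.
From mathcomp Require Import boolp classical_sets.

Set Implicit Arguments.
Unset Strict Implicit.
Unset Printing Implicit Defensive.

Import Order.TTheory GRing.Theory Num.Theory.
Local Open Scope ring_scope.
Local Open Scope quotient_scope.

(* The algebraic tensor product of two modules: formal sums of pairs, modulo *)
(* the congruence generated by the usual relations.                          *)

Section Tensor.
Variables (K : comNzRingType) (A B : lmodType K).

Inductive tensor_eq : seq (A * B) -> seq (A * B) -> Prop :=
| Teq_refl s : tensor_eq s s
| Teq_sym s t : tensor_eq s t -> tensor_eq t s
| Teq_trans s t u : tensor_eq s t -> tensor_eq t u -> tensor_eq s u
| Teq_cat s s' t t' :
    tensor_eq s s' -> tensor_eq t t' -> tensor_eq (s ++ t) (s' ++ t')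
| Teq_swap s t : tensor_eq (s ++ t) (t ++ s)
| Teq_0 b : tensor_eq [:: (0, b)] [::]
| Teq_addl a a' b : tensor_eq [:: (a + a', b)] [:: (a, b); (a', b)]
| Teq_addr a b b' : tensor_eq [:: (a, b + b')] [:: (a, b); (a, b')]
| Teq_scale k a b : tensor_eq [:: (k *: a, b)] [:: (a, k *: b)].

Definition tensor_eqb s t : bool := `[< tensor_eq s t >].

Lemma tensor_eqb_refl : reflexive tensor_eqb.
Proof. by move=> s; apply/asboolP; apply: Teq_refl. Qed.

Lemma tensor_eqb_sym : symmetric tensor_eqb.
Proof. by move=> s t; apply/asboolP/asboolP; apply: Teq_sym. Qed.

Lemma tensor_eqb_trans : transitive tensor_eqb.
Proof. by move=> t s u /asboolP st /asboolP tu; apply/asboolP/(Teq_trans st). Qed.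

Canonical tensor_equiv :=
  EquivRel tensor_eqb tensor_eqb_refl tensor_eqb_sym tensor_eqb_trans.

Definition tensor := {eq_quot tensor_equiv}.

HB.instance Definition _ := Choice.on tensor.
HB.instance Definition _ := Quotient.on tensor.
HB.instance Definition _ := EqQuotient.on tensor.

Definition tclass (s : seq (A * B)) : tensor := \pi s.

Lemma tclassP s t : tclass s = tclass t <-> tensor_eq s t.
Proof.
rewrite /tclass; split => [/eqP|st]; last by apply/eqP; rewrite eqmodE; apply/asboolP.
by rewrite eqmodE => /asboolP.
Qed.

Lemma tclassK (t : tensor) : tclass (repr t) = t.
Proof. exact: reprK. Qed.

Lemma repr_tclass s : tensor_eq (repr (tclass s)) s.
Proof. by apply/tclassP; rewrite tclassK. Qed.

Lemma Teq_map (f : A -> A) (s t : seq (A * B)) :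
  f 0 = 0 -> {morph f : a b / a + b} -> (forall k, {morph f : a / k *: a}) ->
  tensor_eq s t ->
  tensor_eq [seq (f p.1, p.2) | p <- s] [seq (f p.1, p.2) | p <- t].
Proof.
move=> f0 fD fZ; elim=> //=.
- by move=> *; apply: Teq_refl.
- by move=> *; apply: Teq_sym.
- by move=> u v w _ uv _ /(Teq_trans uv).
- by move=> s1 s2 t1 t2 _ h _ h'; rewrite !map_cat; apply: Teq_cat.
- by move=> *; rewrite !map_cat; apply: Teq_swap.
- by move=> b; rewrite f0; apply: Teq_0.
- by move=> *; rewrite fD; apply: Teq_addl.
- by move=> *; apply: Teq_addr.
- by move=> *; rewrite fZ; apply: Teq_scale.
Qed.

Definition tensor_zero : tensor := tclass [::].
Definition tensor_add (s t : tensor) : tensor := tclass (repr s ++ repr t).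
Definition tensor_scale (k : K) (t : tensor) : tensor :=
  tclass [seq (k *: p.1, p.2) | p <- repr t].
Definition tensor_opp (t : tensor) : tensor := tensor_scale (-1) t.

Lemma tclass_cat s t : tclass (s ++ t) = tensor_add (tclass s) (tclass t).
Proof. by apply/tclassP; apply: Teq_cat; apply/Teq_sym/repr_tclass. Qed.

Lemma tclass_scale k s :
  tclass [seq (k *: p.1, p.2) | p <- s] = tensor_scale k (tclass s).
Proof.
apply/tclassP; apply: (@Teq_map (fun a => k *: a)).
- exact: scaler0.
- by move=> a b; rewrite scalerDr.
- by move=> l a; rewrite !scalerA mulrC.
- exact/Teq_sym/repr_tclass.
Qed.

Lemma tensor_addA : associative tensor_add.
Proof.
move=> s t u; rewrite -(tclassK s) -(tclassK t) -(tclassK u).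
by rewrite -!tclass_cat catA.
Qed.

Lemma tensor_addC : commutative tensor_add.
Proof.
move=> s t; rewrite -(tclassK s) -(tclassK t) -!tclass_cat.
by apply/tclassP; apply: Teq_swap.
Qed.

Lemma tensor_add0 : left_id tensor_zero tensor_add.
Proof. by move=> s; rewrite -(tclassK s) -tclass_cat. Qed.

Lemma tensor_scaleA k l t :
  tensor_scale k (tensor_scale l t) = tensor_scale (k * l) t.
Proof.
rewrite -(tclassK t) -!tclass_scale -map_comp; congr tclass.
by apply: eq_map => p /=; rewrite scalerA.
Qed.

Lemma tensor_scale1 : left_id 1 tensor_scale.
Proof.
move=> t; rewrite -(tclassK t) -tclass_scale; congr tclass.
by rewrite -[RHS]map_id; apply: eq_map => -[a b] /=; rewrite scale1r.
Qed.

Lemma tensor_scaleDr : right_distributive tensor_scale tensor_add.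
Proof.
move=> k s t; rewrite -(tclassK s) -(tclassK t).
by rewrite -tclass_cat -!tclass_scale map_cat tclass_cat.
Qed.

Lemma tensor_scaleDl t k l :
  tensor_scale (k + l) t = tensor_add (tensor_scale k t) (tensor_scale l t).
Proof.
rewrite -(tclassK t) -!tclass_scale.
elim: (repr t) => [|[a b] s IHs] /=; first by rewrite -[RHS]tclass_cat.
have cat1 p u : tclass (p :: u) = tensor_add (tclass [:: p]) (tclass u).
  by rewrite -tclass_cat.
rewrite cat1 IHs [tclass ((k *: a, b) :: _)]cat1 [tclass ((l *: a, b) :: _)]cat1.
have -> : tclass [:: ((k + l) *: a, b)] =
    tensor_add (tclass [:: (k *: a, b)]) (tclass [:: (l *: a, b)]).
  by rewrite -tclass_cat; apply/tclassP; rewrite scalerDl; apply: Teq_addl.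
rewrite -!tensor_addA; congr tensor_add.
by rewrite !tensor_addA; congr tensor_add; rewrite tensor_addC.
Qed.

Lemma tensor_scale0 t : tensor_scale 0 t = tensor_zero.
Proof.
rewrite -(tclassK t) -tclass_scale.
elim: (repr t) => [//|[a b] s IHs] /=.
rewrite scale0r -cat1s tclass_cat IHs tensor_addC tensor_add0.
by apply/tclassP; apply: Teq_0.
Qed.

Lemma tensor_addN : left_inverse tensor_zero tensor_opp tensor_add.
Proof.
move=> t; rewrite -{2}(tensor_scale1 t) /tensor_opp -tensor_scaleDl addNr.
exact: tensor_scale0.
Qed.

HB.instance Definition _ := GRing.isZmodule.Build tensor
  tensor_addA tensor_addC tensor_add0 tensor_addN.

HB.instance Definition _ := GRing.Zmodule_isLmodule.Build K tensor
  tensor_scaleA tensor_scale1 tensor_scaleDr tensor_scaleDl.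

Definition tens (a : A) (b : B) : tensor := tclass [:: (a, b)].

Definition biadditive (V : zmodType) (f : A -> B -> V) :=
  (forall b, {morph f^~ b : a a' / a + a'}) /\
  (forall a, {morph f a : b b' / b + b'}).

Definition balanced (V : zmodType) (f : A -> B -> V) :=
  biadditive f /\ forall k a b, f (k *: a) b = f a (k *: b).

(* The additive map with tlift f (tens a b) = f a b. Defined for every f, but *)
(* only meaningful when f is balanced, see tliftE and tlift_is_additive. The  *)
(* codomain is any abelian group, so that conjugate-linear maps lift too.     *)
Definition tlift (V : zmodType) (f : A -> B -> V) (t : tensor) : V :=
  \sum_(p <- repr t) f p.1 p.2.

Lemma tlift_class (V : zmodType) (f : A -> B -> V) s :
  balanced f -> tlift f (tclass s) = \sum_(p <- s) f p.1 p.2.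
Proof.
move=> [[fDl fDr] fZ]; rewrite /tlift.
move: (repr (tclass s)) (repr_tclass s) => r.
have f0 b : f 0 b = 0 by apply: (addrI (f 0 b)); rewrite -fDl !addr0.
elim=> //=.
- by move=> u v w _ -> _ ->.
- by move=> u u' v v' _ h _ h'; rewrite !big_cat /= h h'.
- by move=> u v; rewrite !big_cat /= addrC.
- by move=> b; rewrite big_seq1 big_nil f0.
- by move=> a a' b; rewrite !big_cons !big_nil !addr0 /= fDl.
- by move=> a b b'; rewrite !big_cons !big_nil !addr0 /= fDr.
- by move=> k a b; rewrite !big_seq1 /= fZ.
Qed.

Lemma tliftE (V : zmodType) (f : A -> B -> V) a b :
  balanced f -> tlift f (tens a b) = f a b.
Proof. by move=> fP; rewrite tlift_class // big_seq1. Qed.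

Lemma tlift_is_additive (V : zmodType) (f : A -> B -> V) :
  balanced f -> {morph tlift f : s t / s + t}.
Proof.
move=> fP s t; rewrite -(tclassK s) -(tclassK t).
by rewrite -[_ + _]tclass_cat !tlift_class // big_cat.
Qed.

Lemma tlift0 (V : zmodType) (f : A -> B -> V) : balanced f -> tlift f 0 = 0.
Proof. by move=> fP; rewrite tlift_class // big_nil. Qed.

Lemma tensDl a a' b : tens (a + a') b = tens a b + tens a' b.
Proof. by rewrite -[RHS]tclass_cat; apply/tclassP; apply: Teq_addl. Qed.

Lemma tensDr a b b' : tens a (b + b') = tens a b + tens a b'.
Proof. by rewrite -[RHS]tclass_cat; apply/tclassP; apply: Teq_addr. Qed.

Lemma tensZl k a b : tens (k *: a) b = k *: tens a b.
Proof. by rewrite -[RHS]tclass_scale. Qed.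

Lemma tensZr k a b : tens a (k *: b) = k *: tens a b.
Proof. by rewrite -tensZl; apply/tclassP/Teq_sym/Teq_scale. Qed.

Lemma tens_ind (P : tensor -> Prop) :
  P 0 -> (forall a b, P (tens a b)) -> (forall s t, P s -> P t -> P (s + t)) ->
  forall t, P t.
Proof.
move=> P0 Pt PD t; rewrite -(tclassK t).
elim: (repr t) => [//|[a b] s IHs].
by rewrite -cat1s tclass_cat; apply: (PD (tclass _) (tclass _)) => //; apply: Pt.
Qed.

Lemma tlift_linear (V : lmodType K) (f : A -> B -> V) :
  balanced f -> (forall k a b, f (k *: a) b = k *: f a b) -> linear (tlift f).
Proof.
move=> fP fZ k s t; rewrite tlift_is_additive //; congr (_ + _).
elim/tens_ind: s => [|a b|u v]; first by rewrite scaler0 tlift0 // scaler0.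
  by rewrite -tensZl !tliftE.
by rewrite scalerDr !tlift_is_additive // scalerDr => -> ->.
Qed.

Lemma tlift_eq (V : zmodType) (f g : tensor -> V) :
  {morph f : s t / s + t} -> {morph g : s t / s + t} ->
  (forall a b, f (tens a b) = g (tens a b)) -> f =1 g.
Proof.
move=> fD gD fg t; have z (h : tensor -> V) : {morph h : s t / s + t} -> h 0 = 0.
  by move=> hD; apply: (addrI (h 0)); rewrite -hD !addr0.
elim/tens_ind: t => [|a b|u v hu hv]; first by rewrite !z.
  exact: fg.
by rewrite fD gD hu hv.
Qed.

End Tensor.

Arguments tensor {K} (A B)%_type_scope.
Arguments tens {K A B}.
Arguments tlift {K A B V}.

Notation "A \ot B" := (tensor A B) (at level 40, left associativity) : type_scope.
Notation "a \ot b" := (tens a b) (at level 40, left associativity) : ring_scope.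

Section TensorMaps.
Variable K : comNzRingType.

Definition tmap (A B A' B' : lmodType K) (f : A -> A') (g : B -> B')
  : A \ot B -> A' \ot B' := tlift (fun a b => f a \ot g b).

Lemma linear_morphD (V W : lmodType K) (f : V -> W) :
  linear f -> {morph f : a b / a + b}.
Proof. by move=> fL a b; rewrite -{1}[a]scale1r fL scale1r. Qed.

Lemma linear_morph0 (V W : lmodType K) (f : V -> W) : linear f -> f 0 = 0.
Proof.
by move=> /linear_morphD fD; apply: (addrI (f 0)); rewrite -fD !addr0.
Qed.

Lemma linear_morphZ (V W : lmodType K) (f : V -> W) :
  linear f -> forall k a, f (k *: a) = k *: f a.
Proof. by move=> fL k a; rewrite -[k *: a]addr0 fL linear_morph0 // !addr0. Qed.

Section Tmap.
Variables (A B A' B' : lmodType K) (f : A -> A') (g : B -> B').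
Hypotheses (fL : linear f) (gL : linear g).

Lemma balanced_tens : balanced (fun a b => f a \ot g b).
Proof.
split=> [|k a b]; last by rewrite (linear_morphZ fL) (linear_morphZ gL) tensZl tensZr.
by split=> [b a a'|a b b'];
  rewrite (linear_morphD fL, linear_morphD gL) (tensDl, tensDr).
Qed.

Lemma tmapE a b : tmap f g (a \ot b) = f a \ot g b.
Proof. by rewrite /tmap tliftE //; apply: balanced_tens. Qed.

Lemma tmap_linear : linear (tmap f g).
Proof.
apply: tlift_linear; first exact: balanced_tens.
by move=> k a b; rewrite (linear_morphZ fL) tensZl.
Qed.

End Tmap.

Definition tassoc (A B D : lmodType K) : (A \ot B) \ot D -> A \ot (B \ot D) :=
  tlift (fun s d => tlift (fun a b => a \ot (b \ot d)) s).

Definition slicel (A B : lmodType K) (w : A -> K) : A \ot B -> B :=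
  tlift (fun a b => w a *: b).

Definition slicer (A B : lmodType K) (w : B -> K) : A \ot B -> A :=
  tlift (fun a b => w b *: a).

End TensorMaps.

(* *-algebras, without unit *)

HB.mixin Record isStarAlgebra (C : numClosedFieldType) A of GRing.Lmodule C A := {
  smul : A -> A -> A;
  smulA : associative smul;
  smulDl : left_distributive smul +%R;
  smulDr : right_distributive smul +%R;
  smulZl : forall (k : C) a b, smul (k *: a) b = k *: smul a b;
  smulZr : forall (k : C) a b, smul a (k *: b) = k *: smul a b;
  star : A -> A;
  starK : involutive star;
  starD : {morph star : a b / a + b};
  starZ : forall (k : C) a, star (k *: a) = k^* *: star a;
  starM : forall a b, star (smul a b) = smul (star b) (star a)
}.

#[short(type="starAlgType")]
HB.structure Definition StarAlgebra (C : numClosedFieldType) :=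
  {A of isStarAlgebra C A & GRing.Lmodule C A}.

Notation "a ** b" := (smul a b) (at level 40, left associativity) : ring_scope.

Section TensorStar.
Variables (C : numClosedFieldType) (A B : starAlgType C).

Definition tmul (s t : A \ot B) : A \ot B :=
  tlift (fun a b => tlift (fun a' b' => (a ** a') \ot (b ** b')) t) s.

Definition tstar : A \ot B -> A \ot B := tlift (fun a b => star a \ot star b).

Lemma balanced_mul a b :
  balanced (fun (a' : A) (b' : B) => (a ** a') \ot (b ** b')).
Proof.
split=> [|k a' b']; last by rewrite !smulZr tensZl tensZr.
by split=> [b' a' a''|a' b' b'']; rewrite smulDr (tensDl, tensDr).
Qed.
Hint Resolve balanced_mul : core.

Lemma balanced_tmul t :
  balanced (fun (a : A) (b : B) =>
    tlift (fun a' b' => (a ** a') \ot (b ** b')) t).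
Proof.
split; [split=> [b a a'|a b b']|move=> k a b];
  elim/tens_ind: t => [|c d|u v hu hv].
- by rewrite !tlift0 // addr0.
- by rewrite !tliftE // smulDl tensDl.
- by rewrite !tlift_is_additive // hu hv addrACA.
- by rewrite !tlift0 // addr0.
- by rewrite !tliftE // smulDl tensDr.
- by rewrite !tlift_is_additive // hu hv addrACA.
- by rewrite !tlift0.
- by rewrite !tliftE // !smulZl tensZl tensZr.
- by rewrite !tlift_is_additive // hu hv.
Qed.
Hint Resolve balanced_tmul : core.

Lemma balanced_star : balanced (fun (a : A) (b : B) => star a \ot star b).
Proof.
split=> [|k a b]; last by rewrite !starZ tensZl tensZr.
by split=> [b a a'|a b b']; rewrite starD (tensDl, tensDr).
Qed.
Hint Resolve balanced_star : core.

Lemma tmulE a b a' b' : tmul (a \ot b) (a' \ot b') = (a ** a') \ot (b ** b').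
Proof. by rewrite /tmul !tliftE. Qed.

Lemma tstarE a b : tstar (a \ot b) = star a \ot star b.
Proof. by rewrite /tstar tliftE. Qed.

Lemma tmul0l t : tmul 0 t = 0.
Proof. by rewrite /tmul tlift0. Qed.

Lemma tmulDl : left_distributive tmul +%R.
Proof. by move=> s t u; rewrite /tmul tlift_is_additive. Qed.

Lemma tmulDr : right_distributive tmul +%R.
Proof.
move=> s t u; elim/tens_ind: s => [|a b|v w hv hw].
- by rewrite !tmul0l addr0.
- by rewrite /tmul !tliftE // tlift_is_additive.
- by rewrite !tmulDl hv hw addrACA.
Qed.

Lemma tmul0r t : tmul t 0 = 0.
Proof. by apply: (addrI (tmul t 0)); rewrite -tmulDr !addr0. Qed.

Lemma tmulA : associative tmul.
Proof.
move=> s t u; elim/tens_ind: s => [|a b|v w hv hw]; last by rewrite !tmulDl hv hw.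
  by rewrite !tmul0l.
elim/tens_ind: t => [|c d|v w hv hw].
- by rewrite tmul0l tmul0r tmul0l.
- elim/tens_ind: u => [|c' d'|v w hv hw]; first by rewrite !tmul0r.
    by rewrite !tmulE !smulA.
  by rewrite !tmulDr hv hw.
- by rewrite tmulDl !tmulDr tmulDl hv hw.
Qed.

Lemma tmulZl (k : C) s t : tmul (k *: s) t = k *: tmul s t.
Proof.
elim/tens_ind: s => [|a b|v w hv hw]; first by rewrite scaler0 tmul0l scaler0.
  elim/tens_ind: t => [|c d|v w hv hw]; first by rewrite !tmul0r scaler0.
    by rewrite -tensZl !tmulE smulZl tensZl.
  by rewrite !tmulDr scalerDr hv hw.
by rewrite scalerDr !tmulDl scalerDr hv hw.
Qed.

Lemma tmulZr (k : C) s t : tmul s (k *: t) = k *: tmul s t.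
Proof.
elim/tens_ind: s => [|a b|v w hv hw]; first by rewrite !tmul0l scaler0.
  elim/tens_ind: t => [|c d|v w hv hw]; first by rewrite scaler0 !tmul0r scaler0.
    by rewrite -tensZl !tmulE smulZr tensZl.
  by rewrite scalerDr !tmulDr scalerDr hv hw.
by rewrite !tmulDl scalerDr hv hw.
Qed.

Lemma tstar0 : tstar 0 = 0.
Proof. by rewrite /tstar tlift0. Qed.

Lemma tstarD : {morph tstar : s t / s + t}.
Proof. by move=> s t; rewrite /tstar tlift_is_additive. Qed.

Lemma tstarK : involutive tstar.
Proof.
move=> t; elim/tens_ind: t => [|a b|u v hu hv]; first by rewrite !tstar0.
  by rewrite !tstarE !starK.
by rewrite !tstarD hu hv.
Qed.

Lemma tstarZ (k : C) t : tstar (k *: t) = k^* *: tstar t.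
Proof.
elim/tens_ind: t => [|a b|u v hu hv]; first by rewrite scaler0 tstar0 scaler0.
  by rewrite -tensZl !tstarE starZ tensZl.
by rewrite scalerDr !tstarD scalerDr hu hv.
Qed.

Lemma tstarM s t : tstar (tmul s t) = tmul (tstar t) (tstar s).
Proof.
elim/tens_ind: s => [|a b|v w hv hw].
- by rewrite tmul0l tstar0 tmul0r.
- elim/tens_ind: t => [|c d|v w hv hw].
  + by rewrite tmul0r tstar0 tmul0l.
  + by rewrite tmulE !tstarE tmulE !starM.
  + by rewrite tmulDr !tstarD tmulDl hv hw.
- by rewrite tmulDl !tstarD tmulDr hv hw.
Qed.

HB.instance Definition _ := isStarAlgebra.Build C (tensor A B)
  tmulA tmulDl tmulDr tmulZl tmulZr tstarK tstarD tstarZ tstarM.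

End TensorStar.

Definition nondegenerate (C : numClosedFieldType) (A : starAlgType C) : Prop :=
  (forall a : A, (forall b, a ** b = 0) -> a = 0) /\
  (forall a : A, (forall b, b ** a = 0) -> a = 0).

(* Multipliers as double centralizers: lmul m a is the product m a, and       *)
(* rmul m a is the product a m.                                               *)

Section Multiplier.
Variables (C : numClosedFieldType) (A : starAlgType C).

Record multiplier := Multiplier {
  lmul : A -> A;
  rmul : A -> A;
  lmul_linear : linear lmul;
  rmul_linear : linear rmul;
  lmulM : forall a b, lmul (a ** b) = lmul a ** b;
  rmulM : forall a b, rmul (a ** b) = a ** rmul b;
  lrmul : forall a b, a ** lmul b = rmul a ** b
}.

HB.instance Definition _ := gen_eqMixin multiplier.
HB.instance Definition _ := gen_choiceMixin multiplier.

Lemma multiplierP (m n : multiplier) :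
  lmul m =1 lmul n -> rmul m =1 rmul n -> m = n.
Proof.
case: m n => [l r p1 p2 p3 p4 p5] [l' r' q1 q2 q3 q4 q5] /= /funext el /funext er.
rewrite {}el {}er in p1 p2 p3 p4 p5 *.
by congr Multiplier; apply: Prop_irrelevance.
Qed.

Lemma smul0r (a : A) : a ** 0 = 0.
Proof. by apply: (addrI (a ** 0)); rewrite -smulDr !addr0. Qed.

Lemma smul0l (a : A) : 0 ** a = 0.
Proof. by apply: (addrI (0 ** a)); rewrite -smulDl !addr0. Qed.

Lemma star0 : star 0 = 0 :> A.
Proof. by apply: (addrI (star 0)); rewrite -starD !addr0. Qed.

Program Definition mult_zero :=
  @Multiplier (fun=> 0) (fun=> 0) _ _ _ _ _.
Next Obligation. by move=> k a b; rewrite scaler0 addr0. Qed.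
Next Obligation. by move=> k a b; rewrite scaler0 addr0. Qed.
Next Obligation. by rewrite smul0l. Qed.
Next Obligation. by rewrite smul0r. Qed.
Next Obligation. by rewrite smul0l smul0r. Qed.

Program Definition mult_add (m n : multiplier) :=
  @Multiplier (fun a => lmul m a + lmul n a) (fun a => rmul m a + rmul n a)
    _ _ _ _ _.
Next Obligation.
by move=> k a b; rewrite !lmul_linear scalerDr addrACA.
Qed.
Next Obligation.
by move=> k a b; rewrite !rmul_linear scalerDr addrACA.
Qed.
Next Obligation. by rewrite !lmulM smulDl. Qed.
Next Obligation. by rewrite !rmulM smulDr. Qed.
Next Obligation. by rewrite smulDl smulDr !lrmul. Qed.

Program Definition mult_scale (k : C) (m : multiplier) :=
  @Multiplier (fun a => k *: lmul m a) (fun a => k *: rmul m a) _ _ _ _ _.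
Next Obligation.
by move=> l a b; rewrite lmul_linear scalerDr !scalerA mulrC.
Qed.
Next Obligation.
by move=> l a b; rewrite rmul_linear scalerDr !scalerA mulrC.
Qed.
Next Obligation. by rewrite lmulM smulZl. Qed.
Next Obligation. by rewrite rmulM smulZr. Qed.
Next Obligation. by rewrite smulZl smulZr lrmul. Qed.

Definition mult_opp (m : multiplier) := mult_scale (-1) m.

Lemma mult_addA : associative mult_add.
Proof. by move=> m n p; apply: multiplierP => a /=; rewrite addrA. Qed.

Lemma mult_addC : commutative mult_add.
Proof. by move=> m n; apply: multiplierP => a /=; rewrite addrC. Qed.

Lemma mult_add0 : left_id mult_zero mult_add.
Proof. by move=> m; apply: multiplierP => a /=; rewrite add0r. Qed.

Lemma mult_addN : left_inverse mult_zero mult_opp mult_add.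
Proof. by move=> m; apply: multiplierP => a /=; rewrite scaleN1r addNr. Qed.

HB.instance Definition _ := GRing.isZmodule.Build multiplier
  mult_addA mult_addC mult_add0 mult_addN.

Lemma mult_scaleA (k l : C) m :
  mult_scale k (mult_scale l m) = mult_scale (k * l) m.
Proof. by apply: multiplierP => a /=; rewrite scalerA. Qed.

Lemma mult_scale1 : left_id 1 mult_scale.
Proof. by move=> m; apply: multiplierP => a /=; rewrite scale1r. Qed.

Lemma mult_scaleDr : right_distributive mult_scale +%R.
Proof. by move=> k m n; apply: multiplierP => a /=; rewrite scalerDr. Qed.

Lemma mult_scaleDl m : {morph mult_scale^~ m : k l / k + l}.
Proof. by move=> k l; apply: multiplierP => a /=; rewrite scalerDl. Qed.

HB.instance Definition _ := GRing.Zmodule_isLmodule.Build C multiplier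
  mult_scaleA mult_scale1 mult_scaleDr mult_scaleDl.

Program Definition mult_mul (m n : multiplier) :=
  @Multiplier (fun a => lmul m (lmul n a)) (fun a => rmul n (rmul m a))
    _ _ _ _ _.
Next Obligation. by move=> k a b; rewrite !lmul_linear. Qed.
Next Obligation. by move=> k a b; rewrite !rmul_linear. Qed.
Next Obligation. by rewrite !lmulM. Qed.
Next Obligation. by rewrite !rmulM. Qed.
Next Obligation. by rewrite !lrmul. Qed.

Program Definition mult_star (m : multiplier) :=
  @Multiplier (fun a => star (rmul m (star a))) (fun a => star (lmul m (star a)))
    _ _ _ _ _.
Next Obligation.
by move=> k a b; rewrite starD starZ rmul_linear starD starZ conjCK.
Qed.
Next Obligation.
by move=> k a b; rewrite starD starZ lmul_linear starD starZ conjCK.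
Qed.
Next Obligation. by rewrite starM rmulM starM starK. Qed.
Next Obligation. by rewrite starM lmulM starM starK. Qed.
Next Obligation.
by apply: (can_inj (@starK _ _)); rewrite !starM !starK lrmul.
Qed.

Lemma mult_mulA : associative mult_mul.
Proof. by move=> m n p; apply: multiplierP. Qed.

Lemma mult_mulDl : left_distributive mult_mul +%R.
Proof.
move=> m n p; apply: multiplierP => a //=.
by rewrite (linear_morphD (@rmul_linear p)).
Qed.

Lemma mult_mulDr : right_distributive mult_mul +%R.
Proof.
move=> m n p; apply: multiplierP => a //=.
by rewrite (linear_morphD (@lmul_linear m)).
Qed.

Lemma mult_mulZl (k : C) m n : mult_mul (k *: m) n = k *: mult_mul m n.
Proof.
by apply: multiplierP => a //=; rewrite (linear_morphZ (@rmul_linear n)).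
Qed.

Lemma mult_mulZr (k : C) m n : mult_mul m (k *: n) = k *: mult_mul m n.
Proof.
by apply: multiplierP => a //=; rewrite (linear_morphZ (@lmul_linear m)).
Qed.

Lemma mult_starK : involutive mult_star.
Proof. by move=> m; apply: multiplierP => a /=; rewrite !starK. Qed.

Lemma mult_starD : {morph mult_star : m n / m + n}.
Proof. by move=> m n; apply: multiplierP => a /=; rewrite starD. Qed.

Lemma mult_starZ (k : C) m : mult_star (k *: m) = k^* *: mult_star m.
Proof. by apply: multiplierP => a /=; rewrite starZ. Qed.

Lemma mult_starM m n :
  mult_star (mult_mul m n) = mult_mul (mult_star n) (mult_star m).
Proof. by apply: multiplierP => a /=; rewrite !starK. Qed.

HB.instance Definition _ := isStarAlgebra.Build C multiplier
  mult_mulA mult_mulDl mult_mulDr mult_mulZl mult_mulZr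
  mult_starK mult_starD mult_starZ mult_starM.

Program Definition mult_one := @Multiplier id id _ _ _ _ _.
Solve All Obligations with by [].

Program Definition mult_emb (a : A) :=
  @Multiplier (fun b => a ** b) (fun b => b ** a) _ _ _ _ _.
Next Obligation. by move=> k b c; rewrite smulDr smulZr. Qed.
Next Obligation. by move=> k b c; rewrite smulDl smulZl. Qed.
Next Obligation. by rewrite smulA. Qed.
Next Obligation. by rewrite smulA. Qed.
Next Obligation. by rewrite smulA. Qed.

End Multiplier.

Arguments multiplier {C} A%_type_scope.
Arguments mult_one {C A}.

Section MultTensor.
Variables (C : numClosedFieldType) (A B : starAlgType C).
Variables (m : multiplier A) (n : multiplier B).

Let lP := tmapE (@lmul_linear _ _ m) (@lmul_linear _ _ n).
Let rP := tmapE (@rmul_linear _ _ m) (@rmul_linear _ _ n).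
Let lL := tmap_linear (@lmul_linear _ _ m) (@lmul_linear _ _ n).
Let rL := tmap_linear (@rmul_linear _ _ m) (@rmul_linear _ _ n).

Lemma tmap_lmulM (s t : A \ot B) :
  tmap (lmul m) (lmul n) (s ** t) = tmap (lmul m) (lmul n) s ** t.
Proof.
elim/tens_ind: s => [|a b|u v hu hv].
- by rewrite smul0l (linear_morph0 lL) smul0l.
- elim/tens_ind: t => [|c d|u v hu hv].
  + by rewrite !smul0r (linear_morph0 lL).
  + by rewrite [_ ** _]tmulE !lP [RHS]tmulE !lmulM.
  + by rewrite !smulDr (linear_morphD lL) hu hv.
- by rewrite smulDl !(linear_morphD lL) smulDl hu hv.
Qed.

Lemma tmap_rmulM (s t : A \ot B) :
  tmap (rmul m) (rmul n) (s ** t) = s ** tmap (rmul m) (rmul n) t.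
Proof.
elim/tens_ind: s => [|a b|u v hu hv].
- by rewrite !smul0l (linear_morph0 rL).
- elim/tens_ind: t => [|c d|u v hu hv].
  + by rewrite smul0r (linear_morph0 rL) smul0r.
  + by rewrite [_ ** _]tmulE !rP [RHS]tmulE !rmulM.
  + by rewrite smulDr !(linear_morphD rL) smulDr hu hv.
- by rewrite !smulDl (linear_morphD rL) hu hv.
Qed.

Lemma tmap_lrmul (s t : A \ot B) :
  s ** tmap (lmul m) (lmul n) t = tmap (rmul m) (rmul n) s ** t.
Proof.
elim/tens_ind: s => [|a b|u v hu hv].
- by rewrite (linear_morph0 rL) !smul0l.
- elim/tens_ind: t => [|c d|u v hu hv].
  + by rewrite (linear_morph0 lL) !smul0r.
  + by rewrite lP rP [LHS]tmulE [RHS]tmulE !lrmul.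
  + by rewrite (linear_morphD lL) !smulDr hu hv.
- by rewrite (linear_morphD rL) !smulDl hu hv.
Qed.

Definition mtens : multiplier (A \ot B) :=
  Multiplier lL rL tmap_lmulM tmap_rmulM tmap_lrmul.

End MultTensor.

Section MultiplierHopf.
Variables (C : numClosedFieldType) (A : starAlgType C).

(* T1 and T2 are the maps a (x) a' |-> Delta(a)(1 (x) a') and                 *)
(* a (x) a' |-> (a (x) 1)Delta(a'); Delta determines them, as A (x) A embeds  *)
(* in M(A (x) A). Coassociativity reads                                       *)
(*   (a (x) 1 (x) 1) (Delta (x) id)(Delta(b)(1 (x) c))                        *)
(*     = (id (x) Delta)((a (x) 1)Delta(b)) (1 (x) 1 (x) c),                   *)
(* which is how it makes sense for a comultiplication with values in          *)
(* M(A (x) A).                                                                *)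
Record multHopfStar := MultHopfStar {
  comult :> {linear A -> multiplier (A \ot A)};
  mhopf_nondegenerate : nondegenerate A;
  comultM : forall a b, comult (a ** b) = comult a ** comult b;
  comult_star : forall a, comult (star a) = star (comult a);
  T1 : {linear (A \ot A)%type -> (A \ot A)%type};
  T1E : forall a a',
    mult_emb (T1 (a \ot a')) = comult a ** mtens mult_one (mult_emb a');
  T1_bij : bijective T1;
  T2 : {linear (A \ot A)%type -> (A \ot A)%type};
  T2E : forall a a',
    mult_emb (T2 (a \ot a')) = mtens (mult_emb a) mult_one ** comult a';
  T2_bij : bijective T2;
  comultA : forall a b c,
    tassoc (tmap (fun x => T2 (a \ot x)) id (T1 (b \ot c))) =
    tmap id (fun x => T1 (x \ot c)) (T2 (a \ot b))
}.

Variable Delta : multHopfStar.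

(* The counit and the antipode are characterized by their defining equations, *)
(* which determine them: (eps (x) id)(Delta(a)(1 (x) b)) = ab,                *)
(* m(S (x) id)(Delta(a)(1 (x) b)) = eps(a)b and their mirror images.          *)
Definition is_counit (eps : {scalar A}) : Prop :=
  (forall a b, slicel eps (T1 Delta (a \ot b)) = a ** b) /\
  (forall a b, slicer eps (T2 Delta (a \ot b)) = a ** b).

Definition is_antipode (eps : {scalar A}) (S : {linear A -> A}) : Prop :=
  (forall a b, tlift (fun x y => S x ** y) (T1 Delta (a \ot b)) = eps a *: b) /\
  (forall a b, tlift (fun x y => x ** S y) (T2 Delta (a \ot b)) = eps b *: a).

(* (id (x) w)(Delta(a)) = m in M(A), resp. (w (x) id)(Delta(a)) = m. The two  *)
(* sides of the slice are computed after multiplying Delta(a) by c (x) 1      *)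
(* (resp. 1 (x) c), which brings it into A (x) A.                             *)
Definition is_slicer (w : A -> C) (a : A) (m : multiplier A) : Prop :=
  (forall c t, mult_emb t = Delta a ** mtens (mult_emb c) mult_one ->
     lmul m c = slicer w t) /\
  (forall c t, mult_emb t = mtens (mult_emb c) mult_one ** Delta a ->
     rmul m c = slicer w t).

Definition is_slicel (w : A -> C) (a : A) (m : multiplier A) : Prop :=
  (forall c t, mult_emb t = Delta a ** mtens mult_one (mult_emb c) ->
     lmul m c = slicel w t) /\
  (forall c t, mult_emb t = mtens mult_one (mult_emb c) ** Delta a ->
     rmul m c = slicel w t).

Definition left_integral (phi : {scalar A}) : Prop :=
  (exists a, phi a != 0) /\
  forall a, is_slicer phi a (phi a *: mult_one).

Definition right_integral (psi : {scalar A}) : Prop :=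
  (exists a, psi a != 0) /\
  forall a, is_slicel psi a (psi a *: mult_one).

Definition positive_functional (w : A -> C) : Prop :=
  forall a, 0 <= w (star a ** a).

(* The dual of A is realized inside the functions A -> C. It consists of the  *)
(* dual_left phi a, and also of the dual_right psi S a. Sweedler's formula    *)
(* for the product of b and b' is read as <a, b b'> = b(p), where p in A is   *)
(* the slice (id (x) b')(Delta(a)): for b' in the dual this multiplier lies   *)
(* in A.                                                                      *)

Definition dual_left (phi : A -> C) (a : A) : A -> C := fun x => phi (x ** a).

Definition dual_right (psi : A -> C) (S : A -> A) (a : A) : A -> C :=
  fun x => psi (S x ** a).

Definition dual_mul (b b' : A -> C) : A -> C :=
  fun a => b (xget 0 [set p | is_slicer b' a (mult_emb p)]%classic).

Definition dual_star (S : A -> A) (b : A -> C) : A -> C :=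
  fun a => (b (star (S a)))^*.

(* By faithfulness of the integrals there is at most one a in the sets below. *)
(* A functional without such a representation gets the value eps 0 = 0.       *)
Definition dual_psi (eps phi : A -> C) (b : A -> C) : C :=
  eps (xget 0 [set a | b = dual_left phi a]%classic).

Definition dual_phi (eps psi : A -> C) (S : A -> A) (b : A -> C) : C :=
  eps (xget 0 [set a | b = dual_right psi S a]%classic).

End MultiplierHopf.

(* Main.v *)
(* Everything rests on strong left invariance: for a left integral phi and    *)
(* p = (id (x) phi)(Delta(x)(1 (x) a)) one has                                *)
(*   S(p) = (id (x) phi)((1 (x) x)Delta(a)).                                  *)
(* Put b = phi(. a). Since b* b maps x to conj(b(S(p)^* )), it is phi(. c)    *)
(* with c = (phi (x) id)((a^* (x) 1)Delta(a)), and eps(c) = phi(a^* a). For   *)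
(* (ii) the same computation is applied to psi, using that S reverses         *)
(* products and Delta and that S(S(a)^* )^* = a. Elements of A (x) A are      *)
(* compared through their slices by linear functionals, so that threefold     *)
(* tensor products appear only in coassociativity itself.                     *)

Require Import Defs.
From HB Require Import structures.
From mathcomp Require Import all_boot all_order all_algebra ring.
From mathcomp Require Import boolp classical_sets reals complex.

Set Implicit Arguments.
Unset Strict Implicit.
Unset Printing Implicit Defensive.

Import Order.TTheory GRing.Theory Num.Theory.
Local Open Scope ring_scope.

(** Let b = phi(. a), and for x in A let p = (id (x) phi)(Delta(x)(1 (x) a)). Sweedler's formula
    gives <x, b* b> = <p, b*>, the conjugate of phi(star(S(p)) a). A positive functional is
    Hermitian ([positive_functional_hermitian]), so this is phi(a* S(p)). Strong left invariance
    ([antipode_left_integral_T2]) replaces a* S(p) by (id (x) phi)((1 (x) x)(a* (x) 1)Delta(a)).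
    Exchanging the two slices by phi turns the value into phi(x c) with c = (phi (x) id)((a* (x)
    1)Delta(a)). Hence b* b = phi(. c) lies in the dual, and the counit equation gives eps(c) =
    phi(a* a).

    For b = psi(S(.) a) the slice is p = (psi (x) id)((S(x) (x) 1)Delta(a))
    ([antipode_right_integral]). This uses right invariance and Delta(S(x)) = S(x_2) (x) S(x_1)
    ([comult_antipode_T2]).

    Finally eps(c) must depend only on the functional that c represents. This is the content of
    [left_integral_kernel] and [right_integral_kernel]. The properties of eps and S are derived from
    their defining equations, using that products such as Delta(a)(1 (x) b) span A (x) A. *)

(** * Linear functionals that separate a vector from a subspace *)

Section SeparatingFunctional.
Variables (K : fieldType) (V : lmodType K).

Definition subspace (W : set V) : Prop :=
  W 0 /\ forall k a b, W a -> W b -> W (k *: a + b).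

Lemma maximal_avoiding_subspace (W : set V) v : subspace W -> ~ W v ->
  exists U : set V, [/\ subspace U, (W `<=` U)%classic, ~ U v &
    forall x, exists k, U (x - k *: v)].
Proof.
move=> sW nWv.
pose good U := [/\ subspace U, (W `<=` U)%classic & ~ U v].
(* Zorn's lemma also asks for the union of the empty chain, which is empty and not a subspace; hence
   the alternative [set0]. A maximal U is not empty, since W is larger. *)
have [U [PU maxU]] : exists U, (U = set0 \/ good U) /\
    forall U', (U `<` U')%classic -> ~ (U' = set0 \/ good U').
  apply: Zorn_bigcup => F FP totF.
  have [[G [FG Gg]]|nG] := pselect (exists G, F G /\ good G); last first.
    left; apply/seteqP; split=> // x [G FG Gx].
    have [G0|gG] := FP _ FG; first by rewrite G0 in Gx.
    by case: nG; exists G.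
  have memF x : (\bigcup_(X in F) X)%classic x ->
      exists G', [/\ F G', good G' & G' x].
    move=> [G' FG' G'x]; exists G'; split=> //.
    by have [G'0|] := FP _ FG'; [rewrite G'0 in G'x|].
  right; case: (Gg) => -[G0 _] WG _; split.
  - split; first by exists G.
    move=> k a b /memF[Ga [FGa [[_ Da] _ _] Gaa]]
      /memF[Gb [FGb [[_ Db] _ _] Gbb]].
    have [le|le] := totF _ _ FGa FGb.
      by exists Gb => //; apply: Db => //; apply: le.
    by exists Ga => //; apply: Da => //; apply: le.
  - by move=> x Wx; exists G => //; apply: WG.
  - by move=> /memF[G' [_ [_ _ nG'] /nG']].
have [[U0 UD] WU nUv] : good U.
  have [U0|//] := PU; case: (maxU W); last by right; split.
  rewrite U0; split=> [x //|]; case: sW => W0 _ /(_ _ W0); exact.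
exists U; split=> // x.
have UZ k a : U a -> U (k *: a) by move=> Ua; rewrite -[_ *: _]addr0; apply: UD.
have [Ux|nUx] := pselect (U x); first by exists 0; rewrite scale0r subr0.
apply: contrapT => nk.
(* The span of U and x is still good: were v in it, x would be a multiple of v modulo U. *)
apply: (maxU [set y | exists k, U (y - k *: x)]%classic).
  split=> [y Uy|sub]; first by exists 0; rewrite scale0r subr0.
  by apply: nUx; apply: sub; exists 1; rewrite scale1r subrr.
right; split.
- split=> [|k a b [l Ul] [m Um]]; first by exists 0; rewrite scale0r subr0.
  exists (k * l + m).
  rewrite scalerDl opprD addrACA -scalerA -scalerBr.
  exact: UD.
- by move=> y /WU Uy; exists 0; rewrite scale0r subr0.
- move=> [k Uk]; apply: nk; have [k0|k0] := eqVneq k 0.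
    by case: nUv; rewrite k0 scale0r subr0 in Uk.
  exists k^-1; have := UZ (- k^-1) _ Uk.
  by rewrite scalerBr !scaleNr scalerA mulVf // scale1r opprK addrC.
Qed.

(** A maximal subspace U that contains W and misses v is a complement of the line through v. The
    functional reads off the coefficient of v modulo U. *)
Lemma separating_functional (W : set V) v : subspace W -> ~ W v ->
  exists w : {scalar V}, (forall x, W x -> w x = 0) /\ w v = 1.
Proof.
move=> sW /(maximal_avoiding_subspace sW)[U [[U0 UD] WU nUv compl]].
have uniq x k l : U (x - k *: v) -> U (x - l *: v) -> k = l.
  move=> Uk Ul; apply: contrapT => /eqP; rewrite -subr_eq0 => kl.
  have Ud : U ((k - l) *: v).
    have -> : (k - l) *: v = -1 *: (x - k *: v) + (x - l *: v).
      by rewrite scaleN1r opprB scalerBl addrA subrK.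
    exact: UD.
  apply: nUv; have := UD (k - l)^-1 _ _ Ud U0.
  by rewrite addr0 scalerA mulVf // scale1r.
pose f x := projT1 (cid (compl x)).
have fP x : U (x - f x *: v) by rewrite /f; case: cid.
have fL : scalar f.
  move=> k a b; apply: (uniq _ _ _ (fP _)).
  rewrite scalerDl -scalerA opprD addrACA -scalerBr.
  exact: UD.
pose fS := GRing.isLinear.Build _ _ _ _ f fL.
exists (HB.pack_for {scalar V} f fS); split=> /= [x /WU Ux|].
  by apply: (uniq _ _ _ (fP _)); rewrite scale0r subr0.
by apply: (uniq _ _ _ (fP _)); rewrite scale1r subrr.
Qed.

End SeparatingFunctional.

(** * Linear maps on tensor products, and slices *)

Section TensorLinear.
Variable K : comNzRingType.
Variables A B V W : lmodType K.

Lemma balanced_slicel (w : {scalar A}) :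
  balanced (fun (a : A) (b : B) => w a *: b).
Proof.
split=> [|k a b]; last by rewrite linearZ /= scalerA mulrC.
by split=> [b a a'|a b b'] /=; rewrite ?linearD ?scalerDl ?scalerDr.
Qed.

Lemma balanced_slicer (w : {scalar B}) :
  balanced (fun (a : A) (b : B) => w b *: a).
Proof.
split=> [|k a b]; last by rewrite [w (k *: b)]linearZ /= scalerA mulrC.
by split=> [b a a'|a b b'] /=; rewrite ?linearD ?scalerDl ?scalerDr.
Qed.

Lemma slicelE (w : {scalar A}) (a : A) (b : B) : slicel w (a \ot b) = w a *: b.
Proof. by rewrite /slicel tliftE //; apply: balanced_slicel. Qed.

Lemma slicerE (w : {scalar B}) (a : A) (b : B) : slicer w (a \ot b) = w b *: a.
Proof. by rewrite /slicer tliftE //; apply: balanced_slicer. Qed.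

Lemma slicel_is_linear (w : {scalar A}) : linear (@slicel _ A B w).
Proof.
apply: tlift_linear; first exact: balanced_slicel.
by move=> k a b; rewrite linearZ /= scalerA.
Qed.
HB.instance Definition _ (w : {scalar A}) :=
  GRing.isLinear.Build K (A \ot B)%type B _ (slicel w) (slicel_is_linear w).

Lemma slicer_is_linear (w : {scalar B}) : linear (@slicer _ A B w).
Proof.
apply: tlift_linear; first exact: balanced_slicer.
by move=> k a b; rewrite !scalerA mulrC.
Qed.
HB.instance Definition _ (w : {scalar B}) :=
  GRing.isLinear.Build K (A \ot B)%type A _ (slicer w) (slicer_is_linear w).

Lemma tens_linearr (a : A) : linear (tens a : B -> A \ot B).
Proof. by move=> k b b'; rewrite tensDr tensZr. Qed.
HB.instance Definition _ (a : A) :=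
  GRing.isLinear.Build K B (A \ot B)%type _ (tens a) (tens_linearr a).

Lemma tens0l (b : B) : (0 : A) \ot b = 0.
Proof. by have := tensZl 0 (0 : A) b; rewrite !scale0r. Qed.

Definition tflip : A \ot B -> B \ot A := tlift (fun a b => b \ot a).

Lemma balanced_flip : balanced (fun (a : A) (b : B) => b \ot a).
Proof.
split=> [|k a b]; last by rewrite tensZl tensZr.
by split=> [b a a'|a b b']; rewrite (tensDl, tensDr).
Qed.

Lemma tflipE a b : tflip (a \ot b) = b \ot a.
Proof. by rewrite /tflip tliftE //; apply: balanced_flip. Qed.

Lemma tflip_is_linear : linear tflip.
Proof.
apply: tlift_linear; first exact: balanced_flip.
by move=> k a b; rewrite tensZr.
Qed.
HB.instance Definition _ :=
  GRing.isLinear.Build K (A \ot B)%type (B \ot A)%type _ tflip tflip_is_linear.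

HB.instance Definition _ (f : {linear A -> V}) (g : {linear B -> W}) :=
  GRing.isLinear.Build K (A \ot B)%type (V \ot W)%type _ (tmap f g)
    (tmap_linear (linearP f) (linearP g)).

Lemma tmap_tens (f : {linear A -> V}) (g : {linear B -> W}) a b :
  tmap f g (a \ot b) = f a \ot g b.
Proof. by rewrite tmapE //; apply: linearP. Qed.

End TensorLinear.

Lemma eq_linear_tensor (K : comNzRingType) (A B V : lmodType K)
    (f g : {linear (A \ot B)%type -> V}) :
  (forall a b, f (a \ot b) = g (a \ot b)) -> f =1 g.
Proof. by move=> fg; apply: tlift_eq => // s t; rewrite linearD. Qed.

Section SliceSupport.
Variables (K : fieldType) (A B : lmodType K).

Lemma tensor_sum (t : A \ot B) : exists n (a : 'I_n -> A) (b : 'I_n -> B),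
  t = \sum_(i < n) a i \ot b i.
Proof.
rewrite -(tclassK t); set s := repr t.
exists (size s), (fun i => (tnth (in_tuple s) i).1),
  (fun i => (tnth (in_tuple s) i).2).
rewrite -(big_tnth _ _ s xpredT (fun p => p.1 \ot p.2)).
elim: s => [|[a b] s IHs]; first by rewrite big_nil.
by rewrite big_cons -IHs -cat1s tclass_cat.
Qed.

(* A representation of t with as few terms as possible has linearly           *)
(* independent left legs, so every right leg is a slice of t.                 *)
Lemma tensor_slice_sum (t : A \ot B) :
  exists n (P : {set 'I_n}) (a : 'I_n -> A) (b : 'I_n -> B),
    t = \sum_(i in P) a i \ot b i /\
    forall i, i \in P -> exists w : {scalar A}, b i = slicel w t.
Proof.
have [n [a0 [b0 t0]]] := tensor_sum t.
pose rep m := `[< exists (P : {set 'I_n}) (a : 'I_n -> A) (b : 'I_n -> B),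
  #|P| = m /\ t = \sum_(i in P) a i \ot b i >].
have ex_rep : exists m, rep m.
  exists #|[set: 'I_n]|; apply/asboolP; exists [set: 'I_n], a0, b0; split=> //.
  by rewrite t0; apply: eq_bigl => i; rewrite inE.
case: (ex_minnP ex_rep) => m /asboolP[P [a [b [Pm tE]]]] minm.
exists n, P, a, b; split=> // i iP.
pose W := [set x | exists k : 'I_n -> K,
  x = \sum_(j in P :\ i) k j *: a j]%classic.
have sW : subspace W.
  split; first by exists (fun=> 0); rewrite big1 // => j _; rewrite scale0r.
  move=> k _ _ [l ->] [l' ->]; exists (fun j => k * l j + l' j).
  rewrite scaler_sumr -big_split; apply: eq_bigr => j _.
  by rewrite scalerDl scalerA.
have [w [w0 w1]] : exists w : {scalar A},
    (forall x, W x -> w x = 0) /\ w (a i) = 1.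
  apply: separating_functional => // -[k ai].
  have : (m <= #|P :\ i|)%N.
    apply: minm; apply/asboolP; exists (P :\ i), a, (fun j => b j + k j *: b i).
    split=> //; rewrite tE (big_setD1 i iP) /= ai addrC.
    rewrite (big_morph (fun x => x \ot b i) (fun x y =>
      tensDl x y (b i)) (tens0l _ _)).
    by rewrite -big_split; apply: eq_bigr => j _; rewrite tensDr tensZl tensZr.
  by rewrite -Pm (cardsD1 i P) iP add1n ltnn.
exists w; rewrite tE linear_sum (big_setD1 i iP) /= slicelE w1 scale1r big1
  ?addr0 //.
move=> j jP; rewrite slicelE w0 ?scale0r //; exists (fun l => (l == j)%:R).
rewrite (big_setD1 j jP) /= eqxx scale1r big1 ?addr0 // => l.
by rewrite !inE => /andP[/negPf -> _]; rewrite scale0r.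
Qed.

(** This serves when vanishing is known only on slices of t, as for the kernels of the integrals. *)
Lemma slicel_ind (V : lmodType K) (f : {linear (A \ot B)%type -> V}) t :
  (forall a b, (exists w : {scalar A}, b = slicel w t) -> f (a \ot b) = 0) ->
  f t = 0.
Proof.
move=> f0; have [n [P [a [b [{2}-> bP]]]]] := tensor_slice_sum t.
by rewrite linear_sum big1 // => i /bP; apply: f0.
Qed.

Lemma eq_slicel (s t : A \ot B) :
  (forall w : {scalar A}, slicel w s = slicel w t) -> s = t.
Proof.
move=> st; apply: subr0_eq; apply: (@slicel_ind _ idfun) => a b [w ->] /=.
by rewrite linearB /= st subrr linear0.
Qed.

End SliceSupport.

Section SliceRight.
Variables (K : fieldType) (A B : lmodType K).

Lemma slicel_flip (w : {scalar B}) (t : A \ot B) : slicel w (tflip t) = slicer w t.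
Proof.
apply: (@eq_linear_tensor _ _ _ _ (slicel w \o @tflip _ A B) (slicer w)) => a b /=.
by rewrite tflipE slicelE slicerE.
Qed.

Lemma slicer_ind (V : lmodType K) (f : {linear (A \ot B)%type -> V}) t :
  (forall a b, (exists w : {scalar B}, a = slicer w t) -> f (a \ot b) = 0) ->
  f t = 0.
Proof.
move=> f0; have <- : f (tflip (tflip t)) = f t.
  apply: (@eq_linear_tensor _ _ _ _ (f \o @tflip _ B A \o @tflip _ A B) f) =>
    a b /=.
  by rewrite !tflipE.
apply: (slicel_ind (f := f \o @tflip _ B A)) => b a [w aE] /=.
by rewrite tflipE; apply: f0; exists w; rewrite aE slicel_flip.
Qed.

Lemma eq_slicer (s t : A \ot B) :
  (forall w : {scalar B}, slicer w s = slicer w t) -> s = t.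
Proof.
move=> st; apply: subr0_eq; apply: (@slicer_ind _ idfun) => a b [w ->] /=.
by rewrite linearB /= st subrr tens0l.
Qed.

End SliceRight.

Lemma slice_swap (K : comNzRingType) (A B : lmodType K) (u : {scalar A})
    (w : {scalar B}) (t : A \ot B) : u (slicer w t) = w (slicel u t).
Proof.
apply: (@eq_linear_tensor _ _ _ K^o (u \o slicer w) (w \o slicel u)) => a b /=.
by rewrite slicerE slicelE !linearZ; exact: mulrC.
Qed.

(** * Multiplication on one leg, and non-degeneracy of the tensor product *)

Section StarAlgebraLinear.
Variable C : numClosedFieldType.

Section OneAlgebra.
Variable A : starAlgType C.

Lemma smul_is_linear (a : A) : linear (smul a).
Proof. by move=> k b c; rewrite smulDr smulZr. Qed.
HB.instance Definition _ (a : A) :=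
  GRing.isLinear.Build C A A _ (smul a) (smul_is_linear a).

Definition rsmul (b a : A) : A := a ** b.

Lemma rsmul_is_linear (b : A) : linear (rsmul b).
Proof. by move=> k a c; rewrite /rsmul smulDl smulZl. Qed.
HB.instance Definition _ (b : A) :=
  GRing.isLinear.Build C A A _ (rsmul b) (rsmul_is_linear b).

HB.instance Definition _ (m : multiplier A) :=
  GRing.isLinear.Build C A A _ (lmul m) (@lmul_linear _ _ m).
HB.instance Definition _ (m : multiplier A) :=
  GRing.isLinear.Build C A A _ (rmul m) (@rmul_linear _ _ m).

Definition tmult : A \ot A -> A := tlift (fun a b => a ** b).

Lemma balanced_smul : balanced (fun a b : A => a ** b).
Proof.
split=> [|k a b]; last by rewrite smulZl smulZr.
by split=> [b a a'|a b b']; rewrite (smulDl, smulDr).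
Qed.

Lemma tmultE a b : tmult (a \ot b) = a ** b.
Proof. by rewrite /tmult tliftE //; apply: balanced_smul. Qed.

Lemma tmult_is_linear : linear tmult.
Proof.
apply: tlift_linear; first exact: balanced_smul.
by move=> k a b; rewrite smulZl.
Qed.
HB.instance Definition _ :=
  GRing.isLinear.Build C (A \ot A)%type A _ tmult tmult_is_linear.

Lemma star_inj : injective (@star C A).
Proof. exact: can_inj (@starK _ _). Qed.

Lemma mult_emb_inj : Defs.nondegenerate A -> injective (@mult_emb C A).
Proof.
move=> [nd _] a b /(congr1 (fun m => lmul m)) ab; apply: subr0_eq; apply: nd => c.
have {}ab : a ** c = b ** c := congr1 (fun f => f c) ab.
by rewrite -scaleN1r smulDl smulZl scaleN1r ab subrr.
Qed.

Lemma mult_emb_lmul (m : multiplier A) a : mult_emb (lmul m a) = m ** mult_emb a.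
Proof. by apply: multiplierP => b /=; rewrite (lmulM, lrmul). Qed.

Lemma mult_emb_rmul (m : multiplier A) a : mult_emb (rmul m a) = mult_emb a ** m.
Proof. by apply: multiplierP => b /=; rewrite (rmulM, lrmul). Qed.

Lemma mult_emb_star (a : A) : mult_emb (star a) = star (mult_emb a).
Proof. by apply: multiplierP => b /=; rewrite starM starK. Qed.

Lemma nondegenerate_eql (a b : A) :
  Defs.nondegenerate A -> (forall c, c ** a = c ** b) -> a = b.
Proof.
move=> [_ nd] ab; apply: subr0_eq; apply: nd => c.
by rewrite linearB /= ab subrr.
Qed.

Lemma nondegenerate_eqr (a b : A) :
  Defs.nondegenerate A -> (forall c, a ** c = b ** c) -> a = b.
Proof.
move=> [nd _] ab; apply: subr0_eq; apply: nd => c.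
by rewrite -[LHS]/(rsmul c _) linearB /= /rsmul ab subrr.
Qed.

End OneAlgebra.

Section TwoAlgebras.
Variables A B : starAlgType C.
Implicit Types (a : A) (b : B) (t : A \ot B).

Lemma smul_tens a b a' b' : (a \ot b) ** (a' \ot b') = (a ** a') \ot (b ** b').
Proof. exact: tmulE. Qed.

Lemma star_tens a b : star (a \ot b) = star a \ot star b.
Proof. exact: tstarE. Qed.

(** The elements a (x) 1 and 1 (x) b are only multipliers of A (x) B; these four maps are the left
    and right products with them. *)
Definition lact1 a : A \ot B -> A \ot B := tmap (smul a) idfun.
Definition ract1 a : A \ot B -> A \ot B := tmap (rsmul a) idfun.
Definition lact2 b : A \ot B -> A \ot B := tmap idfun (smul b).
Definition ract2 b : A \ot B -> A \ot B := tmap idfun (rsmul b).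

HB.instance Definition _ a := GRing.isLinear.Build C (A \ot B)%type (A \ot B)%type _
  (lact1 a) (linearP (tmap (smul a) idfun)).
HB.instance Definition _ a := GRing.isLinear.Build C (A \ot B)%type (A \ot B)%type _
  (ract1 a) (linearP (tmap (rsmul a) idfun)).
HB.instance Definition _ b := GRing.isLinear.Build C (A \ot B)%type (A \ot B)%type _
  (lact2 b) (linearP (tmap idfun (smul b))).
HB.instance Definition _ b := GRing.isLinear.Build C (A \ot B)%type (A \ot B)%type _
  (ract2 b) (linearP (tmap idfun (rsmul b))).

Lemma lact1E a a' b : lact1 a (a' \ot b) = (a ** a') \ot b.
Proof. exact: tmap_tens. Qed.
Lemma ract1E a a' b : ract1 a (a' \ot b) = (a' ** a) \ot b.
Proof. exact: tmap_tens. Qed.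
Lemma lact2E b a b' : lact2 b (a \ot b') = a \ot (b ** b').
Proof. exact: tmap_tens. Qed.
Lemma ract2E b a b' : ract2 b (a \ot b') = a \ot (b' ** b).
Proof. exact: tmap_tens. Qed.
Definition actE := (lact1E, ract1E, lact2E, ract2E).

Lemma mult_emb_lact1 a t :
  mult_emb (lact1 a t) = mtens (mult_emb a) mult_one ** mult_emb t.
Proof. exact: (mult_emb_lmul (mtens (mult_emb a) mult_one)). Qed.
Lemma mult_emb_ract1 a t :
  mult_emb (ract1 a t) = mult_emb t ** mtens (mult_emb a) mult_one.
Proof. exact: (mult_emb_rmul (mtens (mult_emb a) mult_one)). Qed.
Lemma mult_emb_lact2 b t :
  mult_emb (lact2 b t) = mtens mult_one (mult_emb b) ** mult_emb t.
Proof. exact: (mult_emb_lmul (mtens mult_one (mult_emb b))). Qed.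
Lemma mult_emb_ract2 b t :
  mult_emb (ract2 b t) = mult_emb t ** mtens mult_one (mult_emb b).
Proof. exact: (mult_emb_rmul (mtens mult_one (mult_emb b))). Qed.

Lemma slicel_ract2 (w : {scalar A}) b t : slicel w (ract2 b t) = slicel w t ** b.
Proof.
apply: (@eq_linear_tensor _ _ _ _ (slicel w \o ract2 b) (rsmul b \o slicel w))
  => c d /=.
by rewrite ract2E !slicelE /rsmul smulZl.
Qed.

Lemma slicel_lact2 (w : {scalar A}) b t : slicel w (lact2 b t) = b ** slicel w t.
Proof.
apply: (@eq_linear_tensor _ _ _ _ (slicel w \o lact2 b) (smul b \o slicel w)) =>
  c d /=.
by rewrite lact2E !slicelE linearZ.
Qed.

Lemma slicer_ract1 (w : {scalar B}) a t : slicer w (ract1 a t) = slicer w t ** a.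
Proof.
apply: (@eq_linear_tensor _ _ _ _ (slicer w \o ract1 a) (rsmul a \o slicer w))
  => c d /=.
by rewrite ract1E !slicerE /rsmul smulZl.
Qed.

Lemma slicer_lact1 (w : {scalar B}) a t : slicer w (lact1 a t) = a ** slicer w t.
Proof.
apply: (@eq_linear_tensor _ _ _ _ (slicer w \o lact1 a) (smul a \o slicer w)) =>
  c d /=.
by rewrite lact1E !slicerE linearZ.
Qed.

Lemma smul_tens_act t a b : t ** (a \ot b) = ract1 a (ract2 b t).
Proof.
apply: (@eq_linear_tensor _ _ _ _ (rsmul (a \ot b)) (ract1 a \o ract2 b)) => c d /=.
by rewrite /rsmul smul_tens !actE.
Qed.

Lemma tens_smul_act t a b : (a \ot b) ** t = lact1 a (lact2 b t).
Proof.
apply: (@eq_linear_tensor _ _ _ _ (smul (a \ot b)) (lact1 a \o lact2 b)) => c d /=.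
by rewrite smul_tens !actE.
Qed.

Lemma ract12C t a b : ract1 a (ract2 b t) = ract2 b (ract1 a t).
Proof.
apply: (@eq_linear_tensor _ _ _ _ (ract1 a \o ract2 b) (ract2 b \o ract1 a)) =>
  c d /=.
by rewrite !actE.
Qed.

Lemma lact12C t a b : lact1 a (lact2 b t) = lact2 b (lact1 a t).
Proof.
apply: (@eq_linear_tensor _ _ _ _ (lact1 a \o lact2 b) (lact2 b \o lact1 a)) =>
  c d /=.
by rewrite !actE.
Qed.

Hypotheses (ndA : Defs.nondegenerate A) (ndB : Defs.nondegenerate B).

Lemma lact1_inj s t : (forall a, lact1 a s = lact1 a t) -> s = t.
Proof.
move=> st; apply: eq_slicer => w; apply: nondegenerate_eql => // a.
by rewrite -!slicer_lact1 st.
Qed.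

Lemma ract1_inj s t : (forall a, ract1 a s = ract1 a t) -> s = t.
Proof.
move=> st; apply: eq_slicer => w; apply: nondegenerate_eqr => // a.
by rewrite -!slicer_ract1 st.
Qed.

Lemma lact2_inj s t : (forall b, lact2 b s = lact2 b t) -> s = t.
Proof.
move=> st; apply: eq_slicel => w; apply: nondegenerate_eql => // b.
by rewrite -!slicel_lact2 st.
Qed.

Lemma ract2_inj s t : (forall b, ract2 b s = ract2 b t) -> s = t.
Proof.
move=> st; apply: eq_slicel => w; apply: nondegenerate_eqr => // b.
by rewrite -!slicel_ract2 st.
Qed.

(** A product with a (x) b acts on one leg at a time, and slicing the other leg reduces each step to
    non-degeneracy of one factor. *)
Lemma nondegenerate_tensor : Defs.nondegenerate (A \ot B)%type.
Proof.
split=> t t0.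
  apply: ract2_inj => b; apply: ract1_inj => a.
  by rewrite -smul_tens_act t0 !linear0.
apply: lact2_inj => b; apply: lact1_inj => a.
by rewrite -tens_smul_act t0 !linear0.
Qed.

End TwoAlgebras.

Lemma mult_emb_tens (A B : starAlgType C) (a : A) (b : B) :
  mult_emb (a \ot b) = mtens (mult_emb a) mult_one ** mtens mult_one (mult_emb b).
Proof.
apply: multiplierP => t /=.
  by rewrite tens_smul_act.
by rewrite smul_tens_act ract12C.
Qed.

Lemma mult_emb_tens' (A B : starAlgType C) (a : A) (b : B) :
  mult_emb (a \ot b) = mtens mult_one (mult_emb b) ** mtens (mult_emb a) mult_one.
Proof.
apply: multiplierP => t /=.
  by rewrite tens_smul_act lact12C.
by rewrite smul_tens_act.
Qed.

End StarAlgebraLinear.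

(** * Slicing the last leg of a threefold tensor product *)

Section TensorAssoc.
Variables (K : comNzRingType) (A B D : lmodType K).

Let bal (d : D) : balanced (fun (a : A) (b : B) => a \ot (b \ot d)).
Proof.
split=> [|k a b]; last by rewrite !tensZl tensZr.
by split=> [b a a'|a b b']; rewrite !(tensDl, tensDr).
Qed.

Let balO : balanced (fun (s : A \ot B) (d : D) =>
  tlift (fun a b => a \ot (b \ot d)) s).
Proof.
split; [split=> [d u v|u d d']|move=> k u d].
- exact: tlift_is_additive.
- elim/tens_ind: u => [|a b|u v hu hv]; first by rewrite !tlift0 // addr0.
    by rewrite !tliftE // !tensDr.
  by rewrite !tlift_is_additive // hu hv addrACA.
- elim/tens_ind: u => [|a b|u v hu hv]; first by rewrite scaler0 !tlift0.
    by rewrite -tensZl !tliftE // !tensZr tensZl.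
  by rewrite scalerDr !tlift_is_additive // hu hv.
Qed.

Lemma tassocE (s : A \ot B) (d : D) :
  tassoc (s \ot d) = tmap idfun (fun b => b \ot d) s.
Proof. by rewrite /tassoc tliftE. Qed.

Lemma tassoc_linear : linear (@tassoc K A B D).
Proof.
have lin (d : D) : linear (tlift (fun (a : A) (b : B) => a \ot (b \ot d))).
  by apply: (tlift_linear (bal d)) => k a b; rewrite tensZl.
by apply: (tlift_linear balO) => k u d; rewrite (linear_morphZ (lin d)).
Qed.

End TensorAssoc.

Lemma slicer_tassoc (K : comNzRingType) (A B D : lmodType K) (w : {scalar D})
    (s : (A \ot B) \ot D) :
  tmap idfun (slicer w) (tassoc s) = slicer w s.
Proof.
have aL := @tassoc_linear K A B D.
elim/tens_ind: s => [|s d|s t hs ht].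
- by rewrite (linear_morph0 aL) !linear0.
- rewrite slicerE tassocE; elim/tens_ind: s => [|a b|s t hs ht].
  + by rewrite (linear_morph0 (tmap_linear _ _)) ?linear0 ?scaler0 // => k b c;
      rewrite tensDl tensZl.
  + rewrite tmapE //; last by move=> k b' c; rewrite tensDl tensZl.
    by rewrite tmap_tens /= slicerE tensZr.
  + rewrite (linear_morphD (tmap_linear _ _)) // => [|k b c];
      last by rewrite tensDl tensZl.
    by rewrite linearD /= hs ht scalerDr.
- by rewrite (linear_morphD aL) !linearD /= hs ht.
Qed.

(** * The comultiplication and its slices *)

Section Comultiplication.
Variables (C : numClosedFieldType) (A : starAlgType C) (Delta : multHopfStar A).
Local Notation T1 := (T1 Delta).
Local Notation T2 := (T2 Delta).
Implicit Types a b c x y z : A.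

Let ndA : Defs.nondegenerate A := mhopf_nondegenerate Delta.
Let ndAA : Defs.nondegenerate (A \ot A)%type := nondegenerate_tensor ndA ndA.

(** Conjugation by the star yields the two remaining products inside A (x) A: [T2r] sends b (x) a to
    Delta(a)(b (x) 1), and [T1r] sends a (x) b to (1 (x) b)Delta(a). *)
Definition T2r (t : A \ot A) : A \ot A := star (T2 (star t)).
Definition T1r (t : A \ot A) : A \ot A := star (T1 (star t)).

Lemma T2r_is_linear : linear T2r.
Proof. by move=> k s t; rewrite /T2r starD starZ linearP /= starD starZ conjCK. Qed.
HB.instance Definition _ :=
  GRing.isLinear.Build C (A \ot A)%type (A \ot A)%type _ T2r T2r_is_linear.

Lemma T1r_is_linear : linear T1r.
Proof. by move=> k s t; rewrite /T1r starD starZ linearP /= starD starZ conjCK. Qed.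
HB.instance Definition _ :=
  GRing.isLinear.Build C (A \ot A)%type (A \ot A)%type _ T1r T1r_is_linear.

Lemma star_lact1 a (t : A \ot A) : star (lact1 a t) = ract1 (star a) (star t).
Proof.
elim/tens_ind: t => [|b c|s t hs ht]; first by rewrite linear0 !star0 linear0.
  by rewrite actE !star_tens actE starM.
by rewrite linearD !starD linearD /= hs ht.
Qed.

Lemma star_lact2 a (t : A \ot A) : star (lact2 a t) = ract2 (star a) (star t).
Proof.
elim/tens_ind: t => [|b c|s t hs ht]; first by rewrite linear0 !star0 linear0.
  by rewrite actE !star_tens actE starM.
by rewrite linearD !starD linearD /= hs ht.
Qed.

Lemma star_mtens1 a :
  star (mtens (mult_emb a) mult_one) = mtens (mult_emb (star a)) (@mult_one C A).
Proof.
apply: multiplierP => t; apply: star_inj; rewrite /= starK.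
  by rewrite -[LHS]/(ract1 a _) -[X in _ = star X]/(lact1 (star a) t)
    star_lact1 starK.
by rewrite -[LHS]/(lact1 a _) -[X in _ = star X]/(ract1 (star a) t) -{2}[t]starK
  -star_lact1 starK.
Qed.

Lemma star_mtens2 a :
  star (mtens mult_one (mult_emb a)) = mtens (@mult_one C A) (mult_emb (star a)).
Proof.
apply: multiplierP => t; apply: star_inj; rewrite /= starK.
  by rewrite -[LHS]/(ract2 a _) -[X in _ = star X]/(lact2 (star a) t)
    star_lact2 starK.
by rewrite -[LHS]/(lact2 a _) -[X in _ = star X]/(ract2 (star a) t) -{2}[t]starK
  -star_lact2 starK.
Qed.

Lemma T2rE b a : mult_emb (T2r (b \ot a)) = Delta a ** mtens (mult_emb b) mult_one.
Proof.
by rewrite /T2r mult_emb_star star_tens T2E starM star_mtens1 comult_star !starK.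
Qed.

Lemma T1rE a b : mult_emb (T1r (a \ot b)) = mtens mult_one (mult_emb b) ** Delta a.
Proof.
by rewrite /T1r mult_emb_star star_tens T1E starM star_mtens2 comult_star !starK.
Qed.

Lemma T1_surj t : exists s, t = T1 s.
Proof. by have [T1' _ T1'K] := T1_bij Delta; exists (T1' t); rewrite T1'K. Qed.

Lemma T2_surj t : exists s, t = T2 s.
Proof. by have [T2' _ T2'K] := T2_bij Delta; exists (T2' t); rewrite T2'K. Qed.

Lemma T2r_surj t : exists s, t = T2r s.
Proof.
by have [s ts] := T2_surj (star t); exists (star s); rewrite /T2r starK -ts starK.
Qed.

(** The identities from here to [lact2_T2_comult] are different bracketings of one product in M(A
    (x) A), into which A (x) A embeds. *)
Lemma comult_T1 a b c : lmul (Delta a) (T1 (b \ot c)) = T1 (a ** b \ot c).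
Proof. by apply: mult_emb_inj => //; rewrite mult_emb_lmul !T1E comultM smulA. Qed.

Lemma comult_T2r a b c : lmul (Delta a) (T2r (c \ot b)) = T2r (c \ot (a ** b)).
Proof. by apply: mult_emb_inj => //; rewrite mult_emb_lmul !T2rE comultM smulA. Qed.

Lemma T1r_comult a b c : rmul (Delta a) (T1r (b \ot c)) = T1r (b ** a \ot c).
Proof. by apply: mult_emb_inj => //; rewrite mult_emb_rmul !T1rE comultM smulA. Qed.

Lemma ract1_T1 a b c : ract1 c (T1 (a \ot b)) = lmul (Delta a) (c \ot b).
Proof.
apply: mult_emb_inj => //.
by rewrite mult_emb_lmul mult_emb_tens' mult_emb_ract1 T1E smulA.
Qed.

Lemma ract2_T2r a b c : ract2 c (T2r (b \ot a)) = lmul (Delta a) (b \ot c).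
Proof.
apply: mult_emb_inj => //.
by rewrite mult_emb_lmul mult_emb_tens mult_emb_ract2 T2rE smulA.
Qed.

Lemma lact1_T1 a b c : lact1 a (T1 (b \ot c)) = ract2 c (T2 (a \ot b)).
Proof.
apply: mult_emb_inj => //.
by rewrite mult_emb_ract2 mult_emb_lact1 T1E T2E smulA.
Qed.

Lemma lact1_T2r a b c : lact1 a (T2r (c \ot b)) = ract1 c (T2 (a \ot b)).
Proof.
apply: mult_emb_inj => //.
by rewrite mult_emb_ract1 mult_emb_lact1 T2rE T2E smulA.
Qed.

Lemma lact2_T1 a b c : lact2 a (T1 (b \ot c)) = ract2 c (T1r (b \ot a)).
Proof.
apply: mult_emb_inj => //.
by rewrite mult_emb_ract2 mult_emb_lact2 T1E T1rE smulA.
Qed.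

Lemma lact2_T2 a b c : lact2 a (T2 (c \ot b)) = lact1 c (T1r (b \ot a)).
Proof.
apply: mult_emb_inj => //.
by rewrite mult_emb_lact1 mult_emb_lact2 T2E T1rE !smulA -mult_emb_tens'
  -mult_emb_tens.
Qed.

Lemma lact1_T1r a b c : lact1 c (T1r (a \ot b)) = rmul (Delta a) (c \ot b).
Proof.
apply: mult_emb_inj => //.
by rewrite mult_emb_rmul mult_emb_tens mult_emb_lact1 T1rE smulA.
Qed.

Lemma lact2_T2_comult a b c : lact2 c (T2 (b \ot a)) = rmul (Delta a) (b \ot c).
Proof. by rewrite lact2_T2 lact1_T1r. Qed.

(** Coassociativity with its third leg sliced by w, so that both sides stay in A (x) A. *)
Lemma comultA_slice (w : {scalar A}) a b c :
  T2 (a \ot slicer w (T1 (b \ot c))) =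
  tmap id (fun x => slicer w (T1 (x \ot c))) (T2 (a \ot b)).
Proof.
have lT1 : linear (fun x => T1 (x \ot c)).
  by move=> k x y; rewrite tensDl tensZl linearP.
have lw : linear (fun x => slicer w (T1 (x \ot c))).
  by move=> k x y; rewrite lT1 linearP.
have := congr1 (tmap idfun (slicer w)) (comultA Delta a b c).
rewrite slicer_tassoc => E; etransitivity; [etransitivity; [|exact: E]|].
  apply/esym; apply: (@tlift_eq _ _ _ _
    (fun t => slicer w (tmap (fun x => T2 (a \ot x)) id t))
    (fun t => T2 (a \ot slicer w t))).
  - by move=> s t; rewrite (linear_morphD (tmap_linear _ _)) ?linearD // =>
      k x y; rewrite !linearP.
  - by move=> s t; rewrite !linearD.
  - by move=> x y; rewrite tmapE // ?slicerE ?linearZ // => k x' y';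
      rewrite !linearP.
apply: (@tlift_eq _ _ _ _
   (fun t => tmap idfun (slicer w) (tmap id (fun x => T1 (x \ot c)) t))
   (tmap id (fun x => slicer w (T1 (x \ot c))))).
- by move=> s t; rewrite (linear_morphD (tmap_linear _ _)) // linearD.
- by move=> s t; rewrite (linear_morphD (tmap_linear _ _)).
- by move=> x y; rewrite tmapE // tmap_tens tmapE.
Qed.

(** The right products with the slice determine the left ones, because (z (x) 1)Delta(a)(c (x) 1)
    can be bracketed in two ways. *)
Lemma is_slicer_emb (w : {scalar A}) a p :
  (forall c, c ** p = slicer w (T2 (c \ot a))) -> is_slicer Delta w a (mult_emb p).
Proof.
move=> pE; split=> c t tE.
  have -> : t = T2r (c \ot a) by apply: mult_emb_inj => //; rewrite T2rE.
  apply: nondegenerate_eql => // z.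
  by rewrite -slicer_lact1 lact1_T2r slicer_ract1 -pE smulA.
have -> : t = T2 (c \ot a) by apply: mult_emb_inj => //; rewrite T2E.
by rewrite -pE.
Qed.

(** By non-degeneracy at most one element of A represents the slice, so the choice made in
    [dual_mul] is p. *)
Lemma dual_mulE (b b' : A -> C) (w : {scalar A}) a p : b' = w ->
  (forall c, c ** p = slicer w (T2 (c \ot a))) -> dual_mul Delta b b' a = b p.
Proof.
move=> -> pE; rewrite /dual_mul; case: xgetP => [q _ /= [_ qE]|/(_ p)[]].
  congr b; apply: nondegenerate_eql => // c.
  by rewrite pE; apply: qE; rewrite T2E.
exact: is_slicer_emb.
Qed.

End Comultiplication.

(** * Counit and antipode, derived from their defining equations *)

Section CounitAntipode.
Variables (C : numClosedFieldType) (A : starAlgType C) (Delta : multHopfStar A).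
Variables (eps : {scalar A}) (S : {linear A -> A}).
Hypotheses (epsP : is_counit Delta eps) (SP : is_antipode Delta eps S).
Variable e : A.
Hypothesis e_neq0 : e != 0.
Local Notation T1 := (T1 Delta).
Local Notation T2 := (T2 Delta).
Local Notation T1r := (T1r Delta).
Local Notation T2r := (T2r Delta).
Implicit Types a b c x y z : A.

Let ndA : Defs.nondegenerate A := mhopf_nondegenerate Delta.
Let ndAA : Defs.nondegenerate (A \ot A)%type := nondegenerate_tensor ndA ndA.

(** The recurring device: a simple tensor is generalized to an arbitrary element of A (x) A and then
    replaced by Delta(a)(1 (x) b), where the equations for eps and S apply. *)
Lemma eq_linear_T1 (V : lmodType C) (f g : {linear (A \ot A)%type -> V}) :
  (forall a b, f (T1 (a \ot b)) = g (T1 (a \ot b))) -> f =1 g.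
Proof.
move=> fg t; have [s ->] := T1_surj Delta t.
exact: (eq_linear_tensor (f := f \o T1) (g := g \o T1)).
Qed.

Lemma eq_linear_T2r (V : lmodType C) (f g : {linear (A \ot A)%type -> V}) :
  (forall a b, f (T2r (a \ot b)) = g (T2r (a \ot b))) -> f =1 g.
Proof.
move=> fg t; have [s ->] := T2r_surj Delta t.
exact: (eq_linear_tensor (f := f \o T2r) (g := g \o T2r)).
Qed.

Lemma scaler_neq0I a (k l : C) : a != 0 -> k *: a = l *: a -> k = l.
Proof.
move=> a0 /eqP; rewrite -subr_eq0 -scalerBl scaler_eq0 (negPf a0) orbF subr_eq0.
by move/eqP.
Qed.

(** If eps vanished, the counit equation would give e b = 0 for all b, against non-degeneracy. *)
Lemma counit_neq0 : exists a, eps a != 0.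
Proof.
apply: contrapT => eps0; case/eqP: e_neq0; apply: ndA.1 => b.
have eps_0 a : eps a = 0 by apply: contrapT => /eqP a0; apply: eps0; exists a.
rewrite -epsP.1; apply: (eq_linear_tensor (f := slicel eps) (g := \0)) => x y /=.
by rewrite slicelE eps_0 scale0r.
Qed.

Lemma counit_comult a t : slicel eps (lmul (Delta a) t) = a ** slicel eps t.
Proof.
apply: (eq_linear_T1 (f := slicel eps \o lmul (Delta a))
  (g := smul a \o slicel eps)).
by move=> b c /=; rewrite comult_T1 !epsP.1 smulA.
Qed.

(** Here eps(ab) e is the slice of (a (x) e)(b (x) 1). With a (x) e replaced by Delta(c)(1 (x) d),
    it becomes the slice of Delta(c)(b (x) d), which is eps(b) c d. *)
Lemma counitM a b : eps (a ** b) = eps a * eps b.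
Proof.
apply: (scaler_neq0I e_neq0);
  rewrite mulrC -scalerA -(slicelE eps a) -slicelE -ract1E.
rewrite -[RHS]/((eps b \*: slicel eps) (a \ot e)).
apply: (eq_linear_T1 (f := slicel eps \o ract1 b) (g := eps b \*: slicel eps)).
move=> c d /=; rewrite ract1_T1 counit_comult slicelE linearZ /=.
by rewrite epsP.1.
Qed.

Lemma counit_T1r a b : slicel eps (T1r (a \ot b)) = b ** a.
Proof.
apply: nondegenerate_eqr => // c.
by rewrite -slicel_ract2 -lact2_T1 slicel_lact2 epsP.1 smulA.
Qed.

(** The functional g, obtained from eps by conjugating with the star, satisfies the counit equation
    too, and T1 being onto forces g = eps. *)
Lemma counit_star a : eps (star a) = (eps a)^*.
Proof.
pose f b := (eps (star b))^*.
have fL : scalar f by move=> k x y;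
  rewrite /f starD starZ linearP /= rmorphD rmorphM /= conjCK.
pose fS := GRing.isLinear.Build _ _ _ _ f fL.
pose g : {scalar A} := HB.pack_for {scalar A} f fS.
have gE t : slicel g t = star (slicel eps (star t)).
  elim/tens_ind: t => [|x y|s t hs ht];
    first by rewrite linear0 star0 linear0 star0.
    by rewrite star_tens !slicelE starZ starK.
  by rewrite starD !linearD starD /= hs ht.
suff ga : g a = eps a by rewrite -ga conjCK.
apply: (scaler_neq0I e_neq0); rewrite -!slicelE.
apply: (eq_linear_T1 (f := slicel g)
  (g := slicel eps)) => x y; rewrite [RHS]epsP.1 [LHS]gE.
rewrite -{1}[x]starK -{1}[y]starK -star_tens -[star (T1 _)]/(T1r _) counit_T1r.
by rewrite starM !starK.
Qed.

Definition antipl (t : A \ot A) : A := tmult (tmap S idfun t).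
Definition antipr (t : A \ot A) : A := tmult (tmap idfun S t).
HB.instance Definition _ := GRing.isLinear.Build C (A \ot A)%type A _ antipl
  (linearP (@tmult _ A \o tmap S idfun)).
HB.instance Definition _ := GRing.isLinear.Build C (A \ot A)%type A _ antipr
  (linearP (@tmult _ A \o tmap idfun S)).

Lemma antiplE a b : antipl (a \ot b) = S a ** b.
Proof. by rewrite /antipl tmap_tens tmultE. Qed.

Lemma antiprE a b : antipr (a \ot b) = a ** S b.
Proof. by rewrite /antipr tmap_tens tmultE. Qed.

Lemma antipl_T1 t : antipl (T1 t) = slicel eps t.
Proof.
apply: (eq_linear_tensor (f := antipl \o T1) (g := slicel eps)) => a b /=.
have bal : balanced (fun x y => S x ** y).
  split=> [|k x y]; last by rewrite linearZ smulZl smulZr.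
  by split=> [y x x'|x y y']; rewrite ?linearD ?smulDl ?smulDr.
rewrite slicelE -SP.1; apply: (@tlift_eq _ _ _ _ antipl) => [u v|u v|x y].
- exact: linearD.
- exact: tlift_is_additive.
- by rewrite antiplE tliftE.
Qed.

Lemma antipr_T2 t : antipr (T2 t) = slicer eps t.
Proof.
apply: (eq_linear_tensor (f := antipr \o T2) (g := slicer eps)) => a b /=.
have bal : balanced (fun x y => x ** S y).
  split=> [|k x y]; last by rewrite linearZ smulZl smulZr.
  by split=> [y x x'|x y y']; rewrite ?linearD ?smulDl ?smulDr.
rewrite slicerE -SP.2; apply: (@tlift_eq _ _ _ _ antipr) => [u v|u v|x y].
- exact: linearD.
- exact: tlift_is_additive.
- by rewrite antiprE tliftE.
Qed.

(** In Sweedler notation S(a_1 u) a_2 v = eps(a) S(u) v. It rests on multiplicativity of eps alone,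
    and so can be used to show that S reverses products. *)
Lemma antipl_comult a t : antipl (lmul (Delta a) t) = eps a *: antipl t.
Proof.
apply: (eq_linear_T1 (f := antipl \o lmul (Delta a)) (g := eps a \*: antipl)).
by move=> b c /=; rewrite comult_T1 !antipl_T1 !slicelE scalerA counitM.
Qed.

Lemma antipl_ract2 b t : antipl (ract2 b t) = antipl t ** b.
Proof.
apply: (eq_linear_tensor (f := antipl \o ract2 b)
  (g := rsmul b \o antipl)) => x y /=.
by rewrite ract2E !antiplE /rsmul smulA.
Qed.

(** After multiplication by c, both sides are linear in a (x) c. On Delta(x)(1 (x) y) both equal
    eps(x) S(b) y. *)
Lemma antipodeM a b : S (a ** b) = S b ** S a.
Proof.
apply: nondegenerate_eqr => // c; rewrite -smulA -(antiplE a) -antiplE -ract1E.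
apply: (eq_linear_T1 (f := antipl \o ract1 b)
  (g := smul (S b) \o antipl)) => x y /=.
by rewrite ract1_T1 antipl_comult antipl_T1 slicelE antiplE linearZ.
Qed.

Lemma antipl_T2r a b : antipl (T2r (a \ot b)) = eps b *: S a.
Proof.
apply: nondegenerate_eqr => // c.
by rewrite -antipl_ract2 ract2_T2r antipl_comult antiplE smulZl.
Qed.

(** For eps(d) nonzero, the antipode equation writes eps(d) c as a sum of products x S(y). *)
Lemma antipode_cancel a b : (forall c, S c ** a = S c ** b) -> a = b.
Proof.
move=> ab; have [d d0] := counit_neq0.
apply: nondegenerate_eql => // c; apply: (scalerI d0); rewrite -!smulZl.
rewrite -slicerE -antipr_T2.
apply: (eq_linear_tensor (f := rsmul a \o antipr)
  (g := rsmul b \o antipr)) => x y /=.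
by rewrite /rsmul antiprE -!smulA ab.
Qed.

Definition antipode_inv a : A := star (S (star a)).

Lemma antipode_inv_is_linear : linear antipode_inv.
Proof. by move=> k a b;
  rewrite /antipode_inv starD starZ linearP starD starZ conjCK. Qed.
HB.instance Definition _ :=
  GRing.isLinear.Build C A A _ antipode_inv antipode_inv_is_linear.

(** It suffices to compare after multiplying by S(c) on the left. Replacing c (x) a by Delta(y)(x
    (x) 1), both sides become eps(y) S(x): one by [antipl_T2r], the other by the starred form of the
    right antipode equation. *)
Lemma antipode_invK : cancel antipode_inv S.
Proof.
move=> a; apply: antipode_cancel => c.
transitivity (tmult (tmap S (S \o antipode_inv) (c \ot a))).
  by rewrite tmap_tens tmultE.
rewrite -antiplE.
apply: (eq_linear_T2r (f := @tmult _ A \o tmap S (S \o antipode_inv))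
  (g := antipl)) => x y /=.
rewrite antipl_T2r.
have E t : tmult (tmap S (S \o antipode_inv) t) = S (star (antipr (star t))).
  elim/tens_ind: t => [|u v|s t hs ht];
    first by rewrite !linear0 !star0 !linear0 star0 linear0.
    by rewrite tmap_tens tmultE star_tens antiprE starM starK antipodeM.
  by rewrite starD !linearD starD linearD /= hs ht.
by rewrite E /T2r starK star_tens antipr_T2 slicerE starZ starK counit_star
  conjCK linearZ.
Qed.

Lemma antipodeK : cancel S antipode_inv.
Proof. by move=> a; apply: star_inj;
  rewrite starK -[RHS]antipode_invK /antipode_inv starK. Qed.

Lemma antipr_T1r a b : antipr (T1r (a \ot b)) = eps a *: S b.
Proof.
apply: nondegenerate_eql => // c.
transitivity (antipr (lact1 c (T1r (a \ot b)))).
  apply: (eq_linear_tensor (f := smul c \o antipr)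
    (g := antipr \o lact1 c)) => x y /=.
  by rewrite lact1E !antiprE smulA.
rewrite -lact2_T2; transitivity (antipr (T2 (c \ot a)) ** S b).
  apply: (eq_linear_tensor (f := antipr \o lact2 b)
    (g := rsmul (S b) \o antipr)) => x y /=.
  by rewrite lact2E !antiprE antipodeM /rsmul smulA.
by rewrite antipr_T2 slicerE smulZl linearZ.
Qed.

(** * The antipode reverses the comultiplication *)

Lemma tmap_idD (V W : lmodType C) (f g h : {linear A -> V}) (t : W \ot A) :
  (forall x, h x = f x + g x) -> tmap idfun h t = tmap idfun f t + tmap idfun g t.
Proof.
move=> hE; elim/tens_ind: t => [|a b|s t hs ht]; first by rewrite !linear0 addr0.
  by rewrite !tmap_tens hE tensDr.
by rewrite !linearD /= hs ht addrACA.
Qed.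

Definition cact (t : A \ot A) a : A \ot A := lmul (Delta a) t.

Lemma cact_is_linear t : linear (cact t).
Proof. by move=> k a b; rewrite /cact linearP. Qed.
HB.instance Definition _ t :=
  GRing.isLinear.Build C A (A \ot A)%type _ (cact t) (cact_is_linear t).

Lemma tens_is_linearl b : linear (fun a : A => a \ot b).
Proof. by move=> k a a'; rewrite tensDl tensZl. Qed.

Definition tensr b a : A \ot A := a \ot b.
HB.instance Definition _ b :=
  GRing.isLinear.Build C A (A \ot A)%type _ (tensr b) (tens_is_linearl b).

(* In Sweedler notation, pent w x t = x_1 w(x_2 t_2) (x) t_1, so T1 maps it   *)
(* to x_1 (x) (id (x) w)(Delta(x_2)t).                                        *)
Definition pent (w : {scalar A}) x (t : A \ot A) : A \ot A :=
  tmap (slicer w \o (T1 \o tens x)) idfun (tflip t).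
HB.instance Definition _ w x := GRing.isLinear.Build C (A \ot A)%type
  (A \ot A)%type _
  (pent w x) (linearP (tmap (slicer w \o (T1 \o tens x)) idfun \o @tflip _ A A)).

(** Coassociativity in the form z x_1 (x) (id (x) w)(Delta(x_2) t); the factor z makes the first leg
    lie in A. *)
Lemma lact1_T1_pent w x z t :
  lact1 z (T1 (pent w x t)) = tmap idfun (slicer w \o cact t) (T2 (z \ot x)).
Proof.
elim/tens_ind: t => [|a b|s t hs ht].
- rewrite !linear0; elim/tens_ind: (T2 _) => [|a b|u v hu hv].
  + by rewrite linear0.
  + by rewrite tmap_tens /= /cact !linear0.
  + by rewrite linearD /= -hu -hv addr0.
- rewrite /pent tflipE tmap_tens /= lact1_T1 comultA_slice.
  apply: (eq_linear_tensor
    (f := ract2 a \o tmap idfun (slicer w \o (T1 \o tensr b)))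
    (g := tmap idfun (slicer w \o cact (a \ot b)))) => c d /=.
  by rewrite !tmap_tens ract2E /= /cact -ract1_T1 slicer_ract1.
- rewrite !linearD /= hs ht; apply/esym/tmap_idD => y /=.
  by rewrite /cact !linearD.
Qed.

Lemma counit_pent w x t : slicel eps (pent w x t) = slicer w (lact2 x t).
Proof.
apply: (eq_linear_tensor (f := slicel eps \o pent w x)
  (g := slicer w \o lact2 x)) => a b /=.
rewrite /pent tflipE tmap_tens slicelE lact2E slicerE /=.
by rewrite slice_swap epsP.1.
Qed.

Lemma T1_pent_T1 w x a k :
  T1 (pent w x (T1 (a \ot k))) =
    tmap idfun (slicer w \o (T1 \o tensr k)) (T1 (x \ot a)).
Proof.
apply: lact1_inj => // z; rewrite lact1_T1_pent.
transitivity (tmap idfun (slicer w \o (T1 \o tensr k)) (lact1 z (T1 (x \ot a)))).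
  rewrite lact1_T1; apply: (eq_linear_tensor
    (f := tmap idfun (slicer w \o cact (T1 (a \ot k))))
    (g := tmap idfun (slicer w \o (T1 \o tensr k)) \o ract2 a)) => c d /=.
  by rewrite ract2E !tmap_tens /= /cact comult_T1.
apply: (eq_linear_tensor (f := tmap idfun (slicer w \o (T1 \o tensr k)) \o lact1 z)
  (g := lact1 z \o tmap idfun (slicer w \o (T1 \o tensr k)))) => c d /=.
by rewrite lact1E !tmap_tens lact1E.
Qed.

(* S(x_1) x_2 a_1 (x) x_3 a_2 k = a_1 (x) x a_2 k, with the second leg        *)
(* sliced by w.                                                               *)
Lemma antipode_coassoc (w : {scalar A}) x a k :
  tmult (tmap S (slicer w \o (T1 \o tensr k)) (T1 (x \ot a))) =
  slicer w (lact2 x (T1 (a \ot k))).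
Proof.
rewrite -counit_pent -antipl_T1 T1_pent_T1.
apply: (eq_linear_tensor (f := @tmult _ A \o tmap S (slicer w \o (T1 \o tensr k)))
  (g := antipl \o tmap idfun (slicer w \o (T1 \o tensr k)))) => c d /=.
by rewrite !tmap_tens tmultE antiplE.
Qed.

Lemma T1r_smul a b t : T1r (a \ot b) ** t = lact2 b (lmul (Delta a) t).
Proof.
apply: mult_emb_inj => //.
by rewrite mult_emb_lact2 mult_emb_lmul smulA -T1rE -mult_emb_lmul.
Qed.

Lemma comultA_map (V : lmodType C) (f : {linear (A \ot A)%type -> V}) a b c :
  tmap idfun f (tassoc (tmap (T2 \o tens a) idfun (T1 (b \ot c)))) =
  tmap idfun (f \o (T1 \o tensr c)) (T2 (a \ot b)).
Proof.
rewrite (comultA Delta).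
apply: (eq_linear_tensor (f := tmap idfun f \o tmap idfun (T1 \o tensr c))
   (g := tmap idfun (f \o (T1 \o tensr c)))) => x y /=.
by rewrite !tmap_tens.
Qed.

(** It sends a (x) b to (1 (x) a)Delta(S(b)), hence (c (x) 1)Delta(x) to (1 (x) c
    x_1)Delta(S(x_2)). *)
Definition comult_antipode (t : A \ot A) : A \ot A := T1r (tflip (tmap idfun S t)).
HB.instance Definition _ := GRing.isLinear.Build C (A \ot A)%type (A \ot A)%type _
  comult_antipode (linearP (T1r \o (@tflip _ A A \o tmap idfun S))).

Lemma comult_antipodeE a b : comult_antipode (a \ot b) = T1r (S b \ot a).
Proof. by rewrite /comult_antipode tmap_tens tflipE. Qed.

(** The left side is (1 (x) c x_1) Delta(S(x_2)) Delta(x_3 a) (1 (x) k). As Delta is multiplicative,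
    S(x_2) x_3 collapses to the counit. *)
Lemma comult_antipode_comult c x a k :
  tmult (tmap (comult_antipode \o (T2 \o tens c)) (T1 \o tensr k) (T1 (x \ot a))) =
  lact2 (c ** x) (T1 (a \ot k)).
Proof.
pose g : {linear (A \ot A)%type -> (A \ot A)%type} :=
  ract2 k \o (T1r \o @tflip _ A A).
pose f : {linear (A \ot (A \ot A))%type -> (A \ot A)%type} :=
  g \o tmap idfun antipl.
transitivity (f (tassoc (tmap (T2 \o tens c) idfun (T1 (x \ot a))))).
  elim/tens_ind: (T1 _) => [|y h|s t hs ht].
  - by rewrite !linear0 (linear_morph0 (@tassoc_linear _ _ _ _)) linear0.
  - rewrite !tmap_tens tmultE tassocE /= -/(tensr h).
    apply: (eq_linear_tensor (f := rsmul (T1 (h \ot k)) \o comult_antipode)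
      (g := f \o tmap idfun (tensr h))) => u v /=.
    rewrite /rsmul comult_antipodeE T1r_smul comult_T1.
    by rewrite !tmap_tens /= tflipE antiplE lact2_T1.
  - by rewrite !linearD (linear_morphD (@tassoc_linear _ _ _ _)) linearD /= hs ht.
rewrite /f /= comultA_map.
have -> : tmap idfun (antipl \o (T1 \o tensr a)) (T2 (c \ot x)) = (c ** x) \ot a.
  rewrite -epsP.2; apply: (eq_linear_tensor
    (f := tmap idfun (antipl \o (T1 \o tensr a)))
      (g := tensr a \o slicer eps)) => u v /=.
  by rewrite tmap_tens /= antipl_T1 slicelE slicerE /tensr tensZl tensZr.
by rewrite tflipE -lact2_T1.
Qed.

(** The same value for (S(x_1) (x) c) Delta(x_2 a) (1 (x) k). After slicing the second leg by w, the
    factor c is absorbed into w and [antipode_coassoc] applies. *)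
Lemma tens_antipode_comult c x a k :
  tmult (tmap (tensr c \o S) (T1 \o tensr k) (T1 (x \ot a))) =
  lact2 (c ** x) (T1 (a \ot k)).
Proof.
apply: eq_slicer => w; pose w' : {scalar A} := w \o smul c.
have w'E t : slicer w (lact2 c t) = slicer w' t.
  apply: (eq_linear_tensor (f := slicer w \o lact2 c) (g := slicer w')) => u v /=.
  by rewrite lact2E !slicerE.
transitivity (slicer w' (lact2 x (T1 (a \ot k)))); last first.
  rewrite -w'E; congr slicer.
  apply: (eq_linear_tensor (f := lact2 c \o lact2 x)
    (g := lact2 (c ** x))) => u v /=.
  by rewrite !lact2E smulA.
rewrite -antipode_coassoc; apply: (eq_linear_tensor
  (f := slicer w \o (@tmult _ _ \o tmap (tensr c \o S) (T1 \o tensr k)))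
  (g := @tmult _ A \o tmap S (slicer w' \o (T1 \o tensr k)))) => u v /=.
rewrite !tmap_tens !tmultE /= /tensr tens_smul_act slicer_lact1; congr (_ ** _).
exact: w'E.
Qed.

(* Delta(S(x)) = S(x_2) (x) S(x_1): both sides are inverse to Delta, in the   *)
(* sense of T1, so they agree because T1 is onto.                             *)
Lemma comult_antipode_T2 c x : comult_antipode (T2 (c \ot x)) = S x \ot c.
Proof.
pose f := comult_antipode \o (T2 \o tens c); pose g := tensr c \o S.
apply: (nondegenerate_eqr ndAA) => t; have [s ->] := T1_surj Delta t.
apply: (eq_linear_tensor (f := smul (f x) \o T1) (g := smul (g x) \o T1)) => h k /=.
transitivity (tmult (tmap f (T1 \o tensr k) (x \ot h)));
  first by rewrite tmap_tens tmultE.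
transitivity (tmult (tmap g (T1 \o tensr k) (x \ot h)));
  last by rewrite tmap_tens tmultE.
(* Replacing x (x) h by Delta(y)(1 (x) a) brings both sides to (1 (x) c y)Delta(a)(1 (x) k). *)
apply: (eq_linear_T1 (f := @tmult _ _ \o tmap f (T1 \o tensr k))
  (g := @tmult _ _ \o tmap g (T1 \o tensr k))) => y a /=.
by rewrite comult_antipode_comult tens_antipode_comult.
Qed.

End CounitAntipode.

(** Polarization: for x = w(a* b) and y = w(b* a), positivity at a + b and at a + i b makes x + y
    and i(x - y) real, so the conjugate of x is y. *)
Lemma positive_functional_hermitian (C : numClosedFieldType) (A : starAlgType C)
    (w : {scalar A}) : positive_functional w ->
  forall a b, (w (star a ** b))^* = w (star b ** a).
Proof.
move=> w_pos a b; set x := w (star a ** b); set y := w (star b ** a).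
have realP c : (w (star c ** c))^* = w (star c ** c).
  by apply/CrealP/ger0_real/w_pos.
have h1 : (x + y)^* = x + y.
  have -> : x + y = w (star (a + b) ** (a + b)) - w (star a ** a) - w (star b ** b).
    by rewrite starD smulDl !smulDr !linearD /= -/x -/y; ring.
  by rewrite !rmorphB /= !realP.
have h2 : ('i * (x - y))^* = 'i * (x - y).
  have -> : 'i * (x - y) =
      w (star (a + 'i *: b) ** (a + 'i *: b)) - w (star a ** a) - w (star b ** b).
    rewrite starD starZ smulDl !smulDr !smulZl !smulZr !linearD /= !linearZ /=
      -/x -/y conjCi.
    by rewrite [- 'i * ('i * _)]mulrA [- 'i * 'i]mulNr -expr2 sqrCi; ring.
  by rewrite !rmorphB /= !realP.
have h3 : x^* - y^* = y - x.
  move: h2; rewrite rmorphM rmorphB /= conjCi => h2.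
  by apply: (mulfI (neq0Ci C)); apply: oppr_inj; rewrite -mulNr h2 -mulrN opprB.
have : x^* *+ 2 = y *+ 2.
  rewrite !mulr2n; move: h1; rewrite rmorphD /= => h1.
  have -> : x^* + x^* = (x^* + y^*) + (x^* - y^*) by ring.
  by rewrite h1 h3; ring.
by move/eqP; rewrite -subr_eq0 -mulrnBl mulrn_eq0 /= subr_eq0 => /eqP.
Qed.

(** * Integrals and the functionals they define *)

Section Integrals.
Variables (C : numClosedFieldType) (A : starAlgType C) (Delta : multHopfStar A).
Variables (eps : {scalar A}) (S : {linear A -> A}).
Hypotheses (epsP : is_counit Delta eps) (SP : is_antipode Delta eps S).
Local Notation T1 := (T1 Delta).
Local Notation T2 := (T2 Delta).
Local Notation T1r := (T1r Delta).
Local Notation T2r := (T2r Delta).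
Implicit Types a b c d x y z : A.

Let ndA : Defs.nondegenerate A := mhopf_nondegenerate Delta.

(** The products S(x) y span A, since eps(a) b is a sum of them and eps is not zero. *)
Lemma functional_antipl (w : {scalar A}) b : w b != 0 ->
  (forall x y, w (S x ** y) = 0) -> False.
Proof.
move=> wb w0; have b0 : b != 0 by apply: contraNneq wb => ->; rewrite linear0.
have [a a0] := counit_neq0 epsP b0.
have : w (antipl S (T1 (a \ot b))) = 0.
  apply: (eq_linear_tensor (V := C^o) (f := w \o antipl S) (g := \0)) => x y /=.
  by rewrite antiplE.
rewrite (antipl_T1 SP) slicelE linearZ /= => /eqP.
by rewrite mulf_eq0 (negPf a0) (negPf wb).
Qed.

Lemma functional_antipr (w : {scalar A}) a : w a != 0 ->
  (forall x y, w (x ** S y) = 0) -> False.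
Proof.
move=> wa w0; have a0 : a != 0 by apply: contraNneq wa => ->; rewrite linear0.
have [b b0] := counit_neq0 epsP a0.
have : w (antipr S (T2 (a \ot b))) = 0.
  apply: (eq_linear_tensor (V := C^o) (f := w \o antipr S) (g := \0)) => x y /=.
  by rewrite antiprE.
rewrite (antipr_T2 SP) slicerE linearZ /= => /eqP.
by rewrite mulf_eq0 (negPf b0) (negPf wa).
Qed.

(** * Left integrals and the first formula *)

Section LeftIntegral.
Variable phi : {scalar A}.
Hypotheses (phi_int : left_integral Delta phi).

Lemma left_integral_T2r y a : slicer phi (T2r (y \ot a)) = phi a *: y.
Proof. by have [_ /(_ a)[/(_ _ _ (T2rE Delta y a)) <- _]] := phi_int. Qed.

(** Strong left invariance. With p the slice on the left, invariance of phi and multiplicativity of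
    Delta give z x_1 (x) (id (x) phi)(Delta(x_2 a)(y (x) 1)) = z p (x) y. So T1 maps the [pent]
    element to p (x) y, and the antipode equation turns S(p) y into its counit slice. *)
Lemma antipode_left_integral x a y :
  S (slicer phi (T1 (x \ot a))) ** y = slicer phi (lact2 x (T2r (y \ot a))).
Proof.
rewrite -(counit_pent epsP) -(antipl_T1 SP) -(antiplE S); congr antipl.
apply: lact1_inj => // z; rewrite lact1_T1_pent lact1E -slicer_lact1 lact1_T1;
  apply/esym.
apply: (eq_linear_tensor (f := tmap idfun (slicer phi \o cact Delta
  (T2r (y \ot a))))
  (g := tensr y \o (slicer phi \o ract2 a))) => c d /=.
rewrite tmap_tens /= /cact comult_T2r left_integral_T2r ract2E slicerE.
by rewrite /tensr tensZl tensZr.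
Qed.

Lemma antipode_left_integral_T2 x a z :
  z ** S (slicer phi (T1 (x \ot a))) = slicer phi (lact2 x (T2 (z \ot a))).
Proof.
apply: nondegenerate_eqr => // y.
rewrite -smulA antipode_left_integral -slicer_lact1 -slicer_ract1 lact12C lact1_T2r.
congr slicer.
apply: (eq_linear_tensor (f := lact2 x \o ract1 y)
  (g := ract1 y \o lact2 x)) => c d /=.
by rewrite !actE.
Qed.

(** Strong left invariance carries the hypothesis over to all slices of Delta(d)(y (x) 1). The map
    m(S (x) id) sends that element to eps(d) S(y), so eps(d) nonzero would make phi vanish on all x
    S(y), hence everywhere. *)
Lemma left_integral_kernel d : (forall x, phi (x ** d) = 0) -> eps d = 0.
Proof.
move=> phi_d; apply: contrapT => /eqP d0.
have [[b phib] _] := phi_int.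
apply: (functional_antipr phib) => x y; apply: (mulfI d0); rewrite mulr0.
have E z (w : {scalar A}) : phi (z ** slicel w (T2r (y \ot d))) = 0.
  suff : slicer phi (lact2 z (T2r (y \ot d))) = 0.
    by move=> /(congr1 w); rewrite slice_swap slicel_lact2 linear0.
  rewrite -antipode_left_integral (_ : slicer _ _ = 0) ?linear0 ?smul0l //.
  apply: nondegenerate_eqr => // c;
    rewrite -slicer_ract1 ract1_T1 smul0l -ract2_T2r.
  apply: (eq_linear_tensor (f := slicer phi \o ract2 d) (g := \0)) => u v /=.
  by rewrite ract2E slicerE phi_d scale0r.
have d_neq0 : d != 0 by apply: contraNneq d0 => ->; rewrite linear0.
have -> : eps d * phi (x ** S y) = phi (x ** antipl S (T2r (y \ot d))).
  by rewrite (antipl_T2r epsP SP d_neq0) !linearZ.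
apply: (slicel_ind (V := C^o) (f := phi \o (smul x \o antipl S))) => u _ [w ->] /=.
by rewrite antiplE smulA E.
Qed.

Lemma dual_left_mul a x : positive_functional phi ->
  let b := dual_left phi a in
  dual_mul Delta (dual_star S b) b x =
  dual_left phi (slicel phi (T2 (star a \ot a))) x.
Proof.
move=> phi_pos b; rewrite (@dual_mulE _ _ _ _ _ (phi \o rsmul a) _
  (slicer phi (T1 (x \ot a)))) // => [|c].
  rewrite /dual_star /b /dual_left positive_functional_hermitian //.
  by rewrite antipode_left_integral_T2 slice_swap slicel_lact2.
rewrite -slicer_lact1 lact1_T1.
apply: (eq_linear_tensor (f := slicer phi \o ract2 a)
  (g := slicer (phi \o rsmul a))) => u v /=.
by rewrite ract2E !slicerE.
Qed.

(** The representative chosen by [xget] differs from c by an element killed by every phi(x .), where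
    eps vanishes. *)
Lemma dual_psi_left c : dual_psi eps phi (dual_left phi c) = eps c.
Proof.
rewrite /dual_psi; case: xgetP => [c' _ /= cc'|/(_ c)[]//].
apply/esym/subr0_eq; rewrite -linearB; apply: left_integral_kernel => x.
by rewrite !linearB /= -[phi (x ** c)]/(dual_left phi c x) cc' subrr.
Qed.

Lemma counit_slicel_T2 a b : eps (slicel phi (T2 (a \ot b))) = phi (a ** b).
Proof. by rewrite -slice_swap epsP.2. Qed.

End LeftIntegral.

(** * Right integrals and the second formula *)

Section RightIntegral.
Variable psi : {scalar A}.
Hypotheses (psi_int : right_integral Delta psi).

Lemma right_integral_T1r a y : slicel psi (T1r (a \ot y)) = psi a *: y.
Proof. by have [_ /(_ a)[_ /(_ _ _ (T1rE Delta a y)) <-]] := psi_int. Qed.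

Let nonzero : exists2 b, psi b != 0 & b != 0.
Proof.
have [[b psib] _] := psi_int; exists b => //.
by apply: contraNneq psib => ->; rewrite linear0.
Qed.

(** Writing S(x) (x) c as (1 (x) c x_1)Delta(S(x_2)) leaves Delta(S(x_2) a), which right invariance
    evaluates to psi(S(x_2) a). *)
Lemma antipode_right_integral a c x :
  c ** slicel psi (T2 (S x \ot a)) = slicer (psi \o (rsmul a \o S)) (T2 (c \ot x)).
Proof.
rewrite -slicel_lact2 lact2_T2_comult -(comult_antipode_T2 epsP SP).
apply: (eq_linear_tensor (f := slicel psi \o (rmul (Delta a) \o comult_antipode
  Delta S))
  (g := slicer (psi \o (rsmul a \o S)))) => u v /=.
by rewrite comult_antipodeE T1r_comult right_integral_T1r slicerE.
Qed.

Lemma antipode_surj y : exists x, y = S x.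
Proof.
have [e _ e0] := nonzero.
by exists (antipode_inv S y); rewrite (antipode_invK epsP SP e0).
Qed.

(** The mirror argument: psi(z .) vanishes on the slices of Delta(d)(1 (x) k) for every z, because z
    is a value of S and [antipode_right_integral] applies. *)
Lemma right_integral_kernel d : (forall x, psi (S x ** d) = 0) -> eps d = 0.
Proof.
move=> psi_d; apply: contrapT => /eqP d0; have [b psib b0] := nonzero.
apply: (functional_antipl psib) => x y; apply: (mulfI d0); rewrite mulr0.
rewrite -[y](antipodeK epsP SP b0); set k := S y.
have E z (w : {scalar A}) : psi (z ** slicer w (T1 (d \ot k))) = 0.
  have [z' ->] := antipode_surj z.
  rewrite -slicer_lact1 lact1_T1 slice_swap slicel_ract2.
  rewrite (_ : slicel _ _ = 0) ?smul0l ?linear0 //.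
  apply: nondegenerate_eql => // c; rewrite antipode_right_integral linear0.
  apply: (eq_linear_tensor (f := slicer (psi \o (rsmul d \o S)))
    (g := \0)) => u v /=.
  by rewrite slicerE /= /rsmul psi_d scale0r.
(* With S' the inverse of S, f sends u (x) v to S'(v) u. The starred form of [antipr_T1r] shows that
   it sends Delta(d)(1 (x) k) to eps(d) S'(k), where k = S(y) was chosen so that S'(k) = y. *)
pose f : {linear (A \ot A)%type -> A} :=
  @tmult _ A \o (tmap (antipode_inv S) idfun \o @tflip _ A A).
have fE t : f t = star (antipr S (star t)).
  elim/tens_ind: t => [|u v|s t hs ht]; first by rewrite !(linear0, star0).
    by rewrite /f /= tflipE tmap_tens tmultE star_tens antiprE starM starK.
  by rewrite linearD hs ht !(starD, linearD).
have -> : eps d * psi (S x ** antipode_inv S k) = psi (S x ** f (T1 (d \ot k))).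
  rewrite fE -{2}[d]starK -{2}[k]starK -star_tens -/(T1r _) (antipr_T1r epsP SP b0).
  by rewrite starZ (counit_star epsP b0) conjCK !linearZ.
apply: (slicer_ind (V := C^o) (f := psi \o (smul (S x) \o f))) => _ v [w ->] /=.
by rewrite tflipE tmap_tens tmultE /= smulA E.
Qed.

Lemma dual_right_mul a x : positive_functional psi ->
  let b := dual_right psi S a in
  dual_mul Delta (dual_star S b) b x =
  dual_right psi S (slicer psi (T1r (a \ot star a))) x.
Proof.
have [e _ e0] := nonzero.
move=> psi_pos b; rewrite (@dual_mulE _ _ _ _ _ (psi \o (rsmul a \o S)) _
  (slicel psi (T2 (S x \ot a)))) // => [|c]; last exact: antipode_right_integral.
set p := slicel _ _; rewrite /dual_star /b /dual_right.
have -> : S (star (S p)) = star p.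
  by rewrite -[RHS](antipode_invK epsP SP e0) /antipode_inv starK.
rewrite positive_functional_hermitian // /p -slicel_lact2 lact2_T2.
by rewrite -slicer_lact1 slice_swap.
Qed.

Lemma dual_phi_right c : dual_phi eps psi S (dual_right psi S c) = eps c.
Proof.
rewrite /dual_phi; case: xgetP => [c' _ /= cc'|/(_ c)[]//].
apply/esym/subr0_eq; rewrite -linearB; apply: right_integral_kernel => x.
by rewrite !linearB /= -[psi (_ ** c)]/(dual_right psi S c x) cc' subrr.
Qed.

Lemma counit_slicer_T1r a b : eps (slicer psi (T1r (a \ot b))) = psi (b ** a).
Proof. by rewrite slice_swap (counit_T1r epsP). Qed.

End RightIntegral.

End Integrals.

Theorem proposition1p12 (R : realType) (A : starAlgType R[i])
    (Delta : multHopfStar A) (eps : {scalar A}) (S : {linear A -> A})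
    (phi psi : {scalar A})
    (epsP : is_counit Delta eps) (SP : is_antipode Delta eps S)
    (phi_int : left_integral Delta phi) (phi_pos : positive_functional phi)
    (psi_int : right_integral Delta psi) (psi_pos : positive_functional psi) :
  (forall a : A,
     let b := dual_left phi a in
     let bb := dual_mul Delta (dual_star S b) b in
     (exists c, bb = dual_left phi c) /\
     dual_psi eps phi bb = phi (star a ** a)) /\
  (forall a : A,
     let b := dual_right psi S a in
     let bb := dual_mul Delta (dual_star S b) b in
     (exists c, bb = dual_right psi S c) /\
     dual_phi eps psi S bb = psi (star a ** a)).
Proof.
split=> a b bb.
  have bbE : bb = dual_left phi (slicel phi (T2 Delta (star a \ot a))).
    by apply/funext => x; exact: (dual_left_mul epsP SP phi_int).
  by split; [eexists; exact: bbE|rewrite bbE (dual_psi_left epsP SP) //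
    counit_slicel_T2].
have bbE : bb = dual_right psi S (slicer psi (T1r Delta (a \ot star a))).
  by apply/funext => x; exact: (dual_right_mul epsP SP psi_int).
by split; [eexists; exact: bbE|rewrite bbE (dual_phi_right epsP SP) //
  counit_slicer_T1r].
Qed.
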